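(* Let $(X,x)\subset(\mathbb{C}^n,x)$, $(Y,y)\subset(\mathbb{C}^m,y)$ and $(Z,z)\subset(\mathbb{C}^l,z)$ be germs of complex analytic spaces, with morphisms $\alpha:(Z,z)\to(X,x)$ and $\beta:(Z,z)\to(Y,y)$ whose induced homomorphisms $\alpha_z^*:\mathcal{O}_{X,x}\to\mathcal{O}_{Z,z}$ and $\beta_z^*:\mathcal{O}_{Y,y}\to\mathcal{O}_{Z,z}$ are surjective and not isomorphisms. Let $(\mathcal{V},v)=(X,x)\sqcup_{(Z,z)}(Y,y)$ and suppose that this gluing is large. Then, for any subspace $(W,w)$ of $(X,x)$: (i) $$\beta_0^{\mathcal{V}}(W)=\frac{\beta_0^{X}(W)\beta_1^{\mathcal{V}}(Y)}{\beta_1^{X}(Z)}.$$ (ii) $$\beta_1^{\mathcal{V}}(W)=\frac{1}{\beta_1^{X}(Z)}\left[\frac{\beta_1^{\mathcal{V}}(Y)\left(\beta_1^{X}(W)\beta_1^{X}(Z)-\beta_0^{X}(W)\beta_2^{X}(Z)\right)}{\beta_1^{X}(Z)}+\beta_0^{X}(W)\beta_2^{\mathcal{V}}(Y)\right].$$ (iii) $$\beta_2^{\mathcal{V}}(W)=\frac{\beta_0^{X}(W)}{\beta_1^{X}(Z)}\left[\beta_3^{\mathcal{V}}(Y)+\frac{\beta_1^{\mathcal{V}}(Y)}{\beta_1^{X}(Z)}\bigl(\beta_2^{X}(Z)k-\beta_3^{X}(Z)\bigr)-k\beta_2^{\mathcal{V}}(Y)\right]+\frac{\beta_1^{X}(W)}{\beta_1^{X}(Z)}\bigl[\beta_2^{\mathcal{V}}(Y)-k\beta_1^{\mathcal{V}}(Y)\bigr]+\frac{\beta_2^{X}(W)\beta_1^{\mathcal{V}}(Y)}{\beta_1^{X}(Z)},$$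 where $k=\dfrac{\beta_2^{X}(Z)}{\beta_1^{X}(Z)}$.
   Context: Germs: for a germ $(X,x)\subset(\mathbb{C}^n,x)$ of a complex analytic space, $\mathcal{O}_{X,x}\cong\mathcal{O}_{\mathbb{C}^n,x}/\mathcal{I}_{X,x}$ where $\mathcal{I}_{X,x}$ is the ideal of all germs of holomorphic functions vanishing on $X$; it is a reduced Noetherian local analytic $\mathbb{C}$-algebra with residue field $\mathbb{C}$. A subspace $(W,w)$ of $(X,x)$ is one defined by a reduced (i.e. radical) ideal $I\subset\mathcal{O}_{X,x}$, with local ring $\mathcal{O}_{X,x}/I$. Betti numbers and Poincaré series: for a finitely generated $\mathcal{O}_{X,x}$-module $M$, $\beta_i^{\mathcal{O}_{X,x}}(M)=\dim_{\mathbb{C}}\mathrm{Tor}_i^{\mathcal{O}_{X,x}}(M,\mathbb{C})$ and $P^{\mathcal{O}_{X,x}}_M(t)=\sum_{i\ge0}\beta_i^{\mathcal{O}_{X,x}}(M)t^i$. For a subspace $(W,w)$ defined by $I$, $\beta_i^{X}(W)=\beta_i^{(X,x)}(W,w):=\beta_i^{\mathcal{O}_{X,x}}(\mathcal{O}_{X,x}/I)$ and $P^{(X,x)}_{(W,w)}(t):=P^{\mathcal{O}_{X,x}}_{\mathcal{O}_{X,x}/I}(t)$. Gluing: $(\mathcal{V},v)=(X,x)\sqcup_{(Z,z)}(Y,y)$ is the pushout of $\alpha:(Z,z)\to(X,x)$ and $\beta:(Z,z)\to(Y,y)$, with canonical morphisms $f:(X,x)\to(\mathcal{V},v)$ and $g:(Y,y)\to(\mathcal{V},v)$.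 Its local ring is the fiber product $\mathcal{O}_{\mathcal{V},v}=\{(s,t)\in\mathcal{O}_{X,x}\times\mathcal{O}_{Y,y}:\alpha_z^*(s)=\beta_z^*(t)\}$, a Noetherian local analytic $\mathbb{C}$-algebra, and $f,g$ correspond to the surjective projections $\pi_1:\mathcal{O}_{\mathcal{V},v}\to\mathcal{O}_{X,x}$ and $\pi_2:\mathcal{O}_{\mathcal{V},v}\to\mathcal{O}_{Y,y}$. Through $\pi_1$ (resp. $\pi_2$), $\mathcal{O}_{X,x}$-modules (resp. $\mathcal{O}_{Y,y}$-modules) are $\mathcal{O}_{\mathcal{V},v}$-modules, and subspaces of $(X,x)$ (resp. $(Y,y)$) are regarded as subspaces of $(\mathcal{V},v)$. Large morphism: a morphism $h:(Y',y')\to(X',x')$ of germs with $\mathcal{O}_{X',x'}\to\mathcal{O}_{Y',y'}$ surjective is large if for every subspace $(W,w)$ of $(Y',y')$, regarded as a subspace of $(X',x')$, one has $P^{(X',x')}_{(W,w)}=P^{(Y',y')}_{(W,w)}P^{(X',x')}_{(Y',y')}$. Large gluing: the morphism $f$ is large. *)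

(* Defs.v *)
From HB Require Import structures.
From mathcomp Require Import all_boot all_order all_algebra complex.
From mathcomp Require Import all_classical reals topology normedtype sequences.

Set Implicit Arguments.
Unset Strict Implicit.
Unset Printing Implicit Defensive.

Import Order.TTheory GRing.Theory Num.Theory.
Import numFieldNormedType.Exports.

Local Open Scope classical_set_scope.
Local Open Scope ring_scope.
Local Open Scope quotient_scope.

(* The type ascription makes the topology that the library puts on every
   numClosedFieldType available on the complex numbers. *)
Definition Cplx (R : realType) : numClosedFieldType := R[i]%C.

Section PowerSeries.
Variables (R : realType) (n : nat).
Local Notation C := (Cplx R).
Implicit Types (x z u : 'rV[C]_n) (f g : 'rV[C]_n -> C) (r M : C).

Definition multi_index := {ffun 'I_n -> nat}.
Implicit Types (nu mu la : multi_index) (a b : multi_index -> C).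

Definition degree nu : nat := (\sum_i nu i)%N.

Definition monomial u nu : C := \prod_i u 0 i ^+ nu i.

Definition of_box N (nu : {ffun 'I_n -> 'I_N}) : multi_index :=
  [ffun i => nu i : nat].

Definition box_sum a u N : C :=
  \sum_(nu : {ffun 'I_n -> 'I_N}) a (of_box nu) * monomial u (of_box nu).

(* f is the sum of a power series on some polydisc centred at x.  The bound on
   the coefficients makes the series absolutely convergent on that polydisc
   (Abel's lemma), so summing over growing cubes loses no generality. *)
Definition holomorphic_at x f : Prop :=
  exists (a : multi_index -> C) (r M : C),
    [/\ 0 < r,
        forall nu, `|a nu| * r ^+ degree nu <= M
      & forall z, (forall i, `|z 0 i - x 0 i| < r) ->
          box_sum a (z - x) N @[N --> \oo] --> f z].

Lemma holomorphic_at_cst x (c : C) : holomorphic_at x (fun=> c).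
Proof.
exists (fun nu => if nu == [ffun=> 0%N] then c else 0), 1, `|c|.
split=> [|nu|z _]; first exact: ltr01.
  by rewrite expr1n mulr1; case: ifP => _ //; rewrite normr0.
apply: cvg_near_cst; near=> N.
have N0 : (0 < N)%N by near: N; exists 1%N.
rewrite /box_sum (bigD1 [ffun=> Ordinal N0])//= big1 ?addr0.
  rewrite (_ : of_box _ = [ffun=> 0%N]); last by apply/ffunP => i; rewrite !ffunE.
  rewrite eqxx /monomial big1 ?mulr1// => i _.
  by rewrite ffunE expr0.
move=> nu nu0; rewrite ifF ?mul0r//; apply/eqP => /ffunP e.
case/eqP: nu0; apply/ffunP => i; apply/val_inj.
by have := e i; rewrite !ffunE.
Unshelve. all: by end_near. Qed.

Lemma coef_bound_le a r r' M : 0 < r' -> r' <= r ->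
  (forall nu, `|a nu| * r ^+ degree nu <= M) ->
  forall nu, `|a nu| * r' ^+ degree nu <= M.
Proof.
move=> r'0 rr' h nu; apply: le_trans (h nu); apply: ler_wpM2l => //.
by apply: lerXn2r => //; rewrite nnegrE ?ltW// (lt_le_trans r'0).
Qed.

Lemma common_radius r1 r2 : 0 < r1 -> 0 < r2 ->
  exists r, [/\ 0 < r, r <= r1 & r <= r2].
Proof.
move=> r10 r20; case: (real_leP (gtr0_real r10) (gtr0_real r20)) => [le12|lt21].
  by exists r1.
by exists r2; split=> //; exact: ltW.
Qed.

Lemma holomorphic_atD x f g :
  holomorphic_at x f -> holomorphic_at x g -> holomorphic_at x (f + g).
Proof.
move=> [a [r1 [M1 [r10 ha fa]]]] [b [r2 [M2 [r20 hb gb]]]].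
have [r [r0 rr1 rr2]] := common_radius r10 r20.
exists (fun nu => a nu + b nu), r, (M1 + M2); split=> // [nu|z zr].
  apply: (@le_trans _ _ ((`|a nu| + `|b nu|) * r ^+ degree nu)).
    by apply: ler_wpM2r; [rewrite exprn_ge0 ?ltW|exact: ler_normD].
  rewrite mulrDl; apply: lerD.
    exact: (coef_bound_le r0 rr1 ha).
  exact: (coef_bound_le r0 rr2 hb).
rewrite [X in X @ _ --> _](_ : _ =
  (fun N => box_sum a (z - x) N + box_sum b (z - x) N)); last first.
  by apply/funext => N; rewrite /box_sum -big_split/=; apply: eq_bigr => nu _;
    rewrite mulrDl.
apply: cvgD; [apply: fa|apply: gb] => i; exact: lt_le_trans (zr i) _.
Qed.

Lemma holomorphic_atN x f : holomorphic_at x f -> holomorphic_at x (- f).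
Proof.
move=> [a [r [M [r0 ha fa]]]]; exists (fun nu => - a nu), r, M.
split=> [|nu|z zr]; [exact: r0|by rewrite normrN; exact: ha|].
rewrite [X in X @ _ --> _](_ : _ = (fun N => - box_sum a (z - x) N)).
  exact: cvgN (fa z zr).
by apply/funext => N; rewrite /box_sum -sumrN; apply: eq_bigr => nu _; rewrite mulNr.
Qed.

Definition add_index mu nu : multi_index := [ffun i => (mu i + nu i)%N].

Lemma degreeD mu nu : degree (add_index mu nu) = (degree mu + degree nu)%N.
Proof. by rewrite /degree -big_split; apply: eq_bigr => i _; rewrite ffunE. Qed.

Lemma monomialD u mu nu :
  monomial u (add_index mu nu) = monomial u mu * monomial u nu.
Proof.
by rewrite /monomial -big_split; apply: eq_bigr => i _; rewrite ffunE exprD.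
Qed.

Lemma of_box_inj N : injective (@of_box N).
Proof.
move=> mu nu /ffunP e; apply/ffunP => i; apply/val_inj.
by have := e i; rewrite !ffunE.
Qed.

Lemma le_degree nu i : (nu i <= degree nu)%N.
Proof. by rewrite /degree (bigD1 i)//= leq_addr. Qed.

Lemma of_boxP N nu : (forall i, (nu i < N)%N) ->
  exists nu' : {ffun 'I_n -> 'I_N}, of_box nu' = nu.
Proof.
move=> h; exists [ffun i => Ordinal (h i)].
by apply/ffunP => i; rewrite !ffunE.
Qed.

Lemma box_indep (F : multi_index -> C) K N : (K <= N)%N ->
  (forall nu i, (K <= nu i)%N -> F nu = 0) ->
  \sum_(nu : {ffun 'I_n -> 'I_N}) F (of_box nu) =
  \sum_(nu : {ffun 'I_n -> 'I_K}) F (of_box nu).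
Proof.
move=> KN F0.
pose h (nu : {ffun 'I_n -> 'I_K}) : {ffun 'I_n -> 'I_N} :=
  [ffun i => widen_ord KN (nu i)].
have hE (nu : {ffun 'I_n -> 'I_K}) : of_box (h nu) = of_box nu by apply/ffunP => i; rewrite !ffunE.
have h_inj : injective h by move=> p q /(congr1 (@of_box N)); rewrite !hE => /of_box_inj.
transitivity (\sum_(nu in h @: finset.setT) F (of_box nu)); last first.
  rewrite big_imset/=; last by move=> p q _ _; exact: h_inj.
  by apply: eq_big => [nu|nu _]; [rewrite finset.inE|rewrite hE].
rewrite (bigID (mem (h @: finset.setT)))/= [X in _ + X]big1 ?addr0// => nu.
apply: contraNeq => Fnu; apply/imsetP.
have lt i : (of_box nu i < K)%N.
  by rewrite ltnNge; apply: contraNN Fnu => /F0 ->.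
have [nu' e] := of_boxP lt; exists nu'; rewrite ?finset.inE//.
by apply: (@of_box_inj N); rewrite hE e.
Qed.

Lemma geometric_box N :
  \sum_(nu : {ffun 'I_n -> 'I_N}) (2%:R^-1 : C) ^+ degree (of_box nu) <= 2 ^+ n.
Proof.
have -> : \sum_(nu : {ffun 'I_n -> 'I_N}) (2%:R^-1 : C) ^+ degree (of_box nu) =
  \prod_(i < n) \sum_(k < N) (2%:R^-1 : C) ^+ k.
  rewrite bigA_distr_bigA/=; apply: eq_bigr => nu _.
  by rewrite /degree -prodrXr; apply: eq_bigr => i _; rewrite ffunE.
rewrite prodr_const card_ord; apply: lerXn2r; rewrite ?nnegrE//.
  by apply: sumr_ge0 => i _; rewrite exprn_ge0// invr_ge0.
have E : \sum_(k < N) (2%:R^-1 : C) ^+ k = 2 - 2 * 2%:R^-1 ^+ N.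
  elim: N => [|N IH]; first by rewrite big_ord0 expr0 mulr1 subrr.
  rewrite big_ord_recr/= IH exprS mulrA mulfV ?pnatr_eq0// mul1r.
  set q := _ ^+ N; rewrite mulr_natl mulr2n opprD -addrA addrNK//.
by rewrite E gerBl mulr_ge0// exprn_ge0// invr_ge0.
Qed.

Definition conv a b nu : C :=
  \sum_(mu : {ffun 'I_n -> 'I_(degree nu).+1})
  \sum_(la : {ffun 'I_n -> 'I_(degree nu).+1})
    (if add_index (of_box mu) (of_box la) == nu
     then a (of_box mu) * b (of_box la) else 0).

Lemma convE a b nu N : (forall i, (nu i < N)%N) -> conv a b nu =
  \sum_(mu : {ffun 'I_n -> 'I_N}) \sum_(la : {ffun 'I_n -> 'I_N})
    (if add_index (of_box mu) (of_box la) == nu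
     then a (of_box mu) * b (of_box la) else 0).
Proof.
move=> nuN.
pose F mu la := if add_index mu la == nu then a mu * b la else 0.
pose S K := \sum_(mu : {ffun 'I_n -> 'I_K}) \sum_(la : {ffun 'I_n -> 'I_K})
  F (of_box mu) (of_box la).
have F0 mu la i K : (nu i < K)%N -> (K <= mu i)%N || (K <= la i)%N -> F mu la = 0.
  move=> nuK h; rewrite /F ifF//; apply/eqP => /ffunP/(_ i); rewrite ffunE => e.
  by move: h nuK; rewrite -e; case/orP => h; rewrite ltnNge ?(leq_trans h)// ?leq_addr ?leq_addl.
have S_indep K K' : (forall i, (nu i < K)%N) -> (K <= K')%N -> S K' = S K.
  move=> nuK KK'; rewrite /S.
  rewrite (@box_indep (fun mu => \sum_la F mu (of_box la)) K K')//; last first.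
    move=> mu i Kmu; apply: big1 => la _.
    by apply: (F0 _ _ i K); rewrite ?nuK ?Kmu.
  apply: eq_bigr => mu _; apply: box_indep => // la i Kla.
  by apply: (F0 _ _ i K); rewrite ?nuK ?Kla ?orbT.
have nud i : (nu i < (degree nu).+1)%N by rewrite ltnS le_degree.
rewrite -[LHS]/(S _) -[RHS]/(S _).
by rewrite -(S_indep _ (maxn N (degree nu).+1) nud) ?leq_maxr//
           (S_indep _ _ nuN) ?leq_maxl.
Qed.

Local Notation half := (2%:R^-1 : C).

Lemma half_ge0 : 0 <= half. Proof. by rewrite invr_ge0. Qed.
Lemma half_le1 : half <= 1. Proof. by rewrite invf_le1 ?ltr0n// ler1n. Qed.

Lemma conv_term a b r M1 M2 mu la : 0 < r ->
  (forall nu, `|a nu| * r ^+ degree nu <= M1) ->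
  (forall nu, `|b nu| * r ^+ degree nu <= M2) ->
  `|a mu * b la| * (r / 4%:R) ^+ degree (add_index mu la) <=
  half ^+ degree (add_index mu la) *
    (M1 * M2 * (half ^+ degree mu * half ^+ degree la)).
Proof.
move=> r0 ha hb.
have -> : (r / 4%:R) = half * (half * r).
  by rewrite mulrA -invfM -natrM mulrC.
rewrite !exprMn degreeD mulrCA normrM; apply: ler_wpM2l.
  by rewrite exprn_ge0// half_ge0.
rewrite mulrCA -exprD mulrC; apply: ler_wpM2r; first by rewrite exprn_ge0// half_ge0.
by rewrite exprD mulrACA; apply: ler_pM; rewrite ?mulr_ge0 ?exprn_ge0// ltW.
Qed.

Lemma conv_box M1 M2 N : 0 <= M1 -> 0 <= M2 ->
  \sum_(mu : {ffun 'I_n -> 'I_N}) \sum_(la : {ffun 'I_n -> 'I_N})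
    (M1 * M2 * (half ^+ degree (of_box mu) * half ^+ degree (of_box la))) <=
  M1 * M2 * (2 ^+ n * 2 ^+ n).
Proof.
move=> M10 M20; under eq_bigr do rewrite -mulr_sumr -mulr_sumr.
rewrite -mulr_sumr -mulr_suml; apply: ler_wpM2l; first exact: mulr_ge0.
by apply: ler_pM; rewrite ?geometric_box//; apply: sumr_ge0 => i _;
  rewrite exprn_ge0// half_ge0.
Qed.

Lemma conv_defect a b u r M1 M2 N : 0 < r ->
  (forall nu, `|a nu| * r ^+ degree nu <= M1) ->
  (forall nu, `|b nu| * r ^+ degree nu <= M2) ->
  (forall i, `|u 0 i| < r / 4%:R) ->
  `|box_sum a u N * box_sum b u N - box_sum (conv a b) u N| <=
  half ^+ N * (M1 * M2 * (2 ^+ n * 2 ^+ n)).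
Proof.
move=> r0 ha hb ur.
have M10 : 0 <= M1 by apply: le_trans (ha [ffun=> 0%N]); rewrite mulr_ge0// exprn_ge0 ?ltW.
have M20 : 0 <= M2 by apply: le_trans (hb [ffun=> 0%N]); rewrite mulr_ge0// exprn_ge0 ?ltW.
pose t mu la := a mu * b la * monomial u (add_index mu la).
have -> : box_sum (conv a b) u N =
    \sum_(mu : {ffun 'I_n -> 'I_N}) \sum_(la : {ffun 'I_n -> 'I_N})
      (if [forall i, (add_index (of_box mu) (of_box la) i < N)%N]
       then t (of_box mu) (of_box la) else 0).
  transitivity (\sum_(nu : {ffun 'I_n -> 'I_N})
    \sum_(mu : {ffun 'I_n -> 'I_N}) \sum_(la : {ffun 'I_n -> 'I_N})
      (if add_index (of_box mu) (of_box la) == of_box nu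
       then t (of_box mu) (of_box la) else 0)).
    apply: eq_bigr => nu _; rewrite (@convE _ _ _ N); last first.
      by move=> i; rewrite ffunE.
    rewrite mulr_suml; apply: eq_bigr => mu _; rewrite mulr_suml.
    by apply: eq_bigr => la _; case: eqP => [<-//|_]; rewrite mul0r.
  rewrite exchange_big; apply: eq_bigr => mu _.
  rewrite exchange_big; apply: eq_bigr => la _ /=.
  case: forallP => [/of_boxP[nu <-]|out].
    rewrite -big_mkcond (big_pred1 nu)// => nu' /=.
    by rewrite eq_sym (inj_eq (@of_box_inj N)).
  apply: big1 => nu _; rewrite ifF//; apply/eqP => e; apply: out => i.
  by rewrite e ffunE.
have -> : box_sum a u N * box_sum b u N =
    \sum_(mu : {ffun 'I_n -> 'I_N}) \sum_(la : {ffun 'I_n -> 'I_N})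
      t (of_box mu) (of_box la).
  rewrite /box_sum mulr_suml; apply: eq_bigr => mu _.
  rewrite mulr_sumr; apply: eq_bigr => la _.
  by rewrite mulrACA -monomialD.
rewrite -sumrB; under eq_bigr do rewrite -sumrB.
apply: le_trans (_ : half ^+ N * (\sum_(mu : {ffun 'I_n -> 'I_N})
  \sum_(la : {ffun 'I_n -> 'I_N})
    (M1 * M2 * (half ^+ degree (of_box mu) * half ^+ degree (of_box la)))) <= _);
  last first.
  by apply: ler_wpM2l; rewrite ?exprn_ge0 ?half_ge0 ?conv_box.
rewrite mulr_sumr; apply: le_trans (ler_norm_sum _ _ _) _; apply: ler_sum => mu _.
rewrite mulr_sumr; apply: le_trans (ler_norm_sum _ _ _) _; apply: ler_sum => la _.
have pos : 0 <= M1 * M2 * (half ^+ degree (of_box mu) * half ^+ degree (of_box la)).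
  by rewrite !mulr_ge0// exprn_ge0// half_ge0.
case: ifPn => [_|/forallPn[k]].
  by rewrite subrr normr0 mulr_ge0// exprn_ge0// half_ge0.
rewrite subr0 -leqNgt => Nk; rewrite /t normrM.
apply: le_trans (_ : `|a (of_box mu) * b (of_box la)| *
  (r / 4%:R) ^+ degree (add_index (of_box mu) (of_box la)) <= _).
  apply: ler_wpM2l => //; rewrite /monomial normr_prod /degree -prodrXr.
  apply: ler_prod => j _; rewrite normr_ge0/= normrX.
  by apply: lerXn2r; rewrite ?nnegrE ?(ltW (ur j))// divr_ge0// ltW.
apply: le_trans (conv_term _ _ r0 ha hb) _; apply: ler_wpM2r => //.
apply: ler_wiXn2l; rewrite ?half_ge0 ?half_le1//.
exact: leq_trans Nk (le_degree _ k).
Qed.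

Lemma cvg_half (K : C) : 0 <= K -> half ^+ N * K @[N --> \oo] --> (0 : C).
Proof.
move=> K0; apply/cvgrPdist_lt => e e0.
have Ke0 : 0 <= K / e by rewrite divr_ge0// ltW.
have [k kE] : exists k : R, K / e = (k%:C)%C.
  by exists (complex.Re (K / e)); rewrite RRe_real// ger0_real.
have k0 : 0 <= k by rewrite -ler0c -kE.
exists (Num.bound k) => // N /= kN.
rewrite sub0r normrN ger0_norm ?mulr_ge0 ?exprn_ge0 ?half_ge0//.
rewrite exprVn mulrC ltr_pdivrMr ?exprn_gt0// mulrC -ltr_pdivrMr// kE.
rewrite (_ : (2 : C) ^+ N = ((2 ^+ N : R)%R%:C)%C); last by rewrite rmorphXn rmorph_nat.
rewrite ltcR; apply: lt_trans (archi_boundP k0) _.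
by rewrite -natrX ltr_nat (leq_ltn_trans kN)// ltn_expl.
Qed.

Lemma holomorphic_atM x f g :
  holomorphic_at x f -> holomorphic_at x g -> holomorphic_at x (f * g).
Proof.
move=> [a [r1 [M1 [r10 ha fa]]]] [b [r2 [M2 [r20 hb gb]]]].
have [r [r0 rr1 rr2]] := common_radius r10 r20.
have {}ha := coef_bound_le r0 rr1 ha; have {}hb := coef_bound_le r0 rr2 hb.
have M10 : 0 <= M1 by apply: le_trans (ha [ffun=> 0%N]); rewrite mulr_ge0// exprn_ge0 ?ltW.
have M20 : 0 <= M2 by apply: le_trans (hb [ffun=> 0%N]); rewrite mulr_ge0// exprn_ge0 ?ltW.
have r40 : 0 < r / 4%:R by rewrite divr_gt0.
have r4r : r / 4%:R <= r.
  by rewrite ler_pdivrMr// mulr_natr mulrS lerDl mulrn_wge0// ltW.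
exists (conv a b), (r / 4%:R), (M1 * M2 * (2 ^+ n * 2 ^+ n)); split=> // [nu|z zr].
  apply: le_trans (conv_box (degree nu).+1 M10 M20).
  rewrite /conv; apply: le_trans (ler_wpM2r _ (ler_norm_sum _ _ _)) _.
    by rewrite exprn_ge0// ltW.
  rewrite mulr_suml; apply: ler_sum => mu _.
  apply: le_trans (ler_wpM2r _ (ler_norm_sum _ _ _)) _.
    by rewrite exprn_ge0// ltW.
  rewrite mulr_suml; apply: ler_sum => la _.
  have pos : 0 <= M1 * M2 * (half ^+ degree (of_box mu) * half ^+ degree (of_box la)).
    by rewrite !mulr_ge0// exprn_ge0// half_ge0.
  case: eqP => [e|_]; last by rewrite normr0 mul0r.
  have := conv_term (of_box mu) (of_box la) r0 ha hb; rewrite e => /le_trans; apply.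
  by rewrite ler_piMl// exprn_ile1 ?half_ge0 ?half_le1.
pose d N := box_sum a (z - x) N * box_sum b (z - x) N - box_sum (conv a b) (z - x) N.
have d0 : d N @[N --> \oo] --> (0 : C).
  apply/cvgrPdist_lt => e e0.
  have K0 : 0 <= M1 * M2 * (2 ^+ n * 2 ^+ n) by rewrite !mulr_ge0// exprn_ge0.
  have /cvgrPdist_lt/(_ _ e0) := cvg_half K0; apply: filterS => N.
  rewrite !sub0r !normrN; apply: le_lt_trans; rewrite [leRHS]ger0_norm; last first.
    by rewrite mulr_ge0// exprn_ge0// half_ge0.
  by apply: conv_defect r0 ha hb _ => i; rewrite !mxE; exact: zr.
have zr' i : `|z 0 i - x 0 i| < r by exact: lt_le_trans (zr i) r4r.
rewrite [X in X @ _ --> _](_ : _ =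
  (fun N => box_sum a (z - x) N * box_sum b (z - x) N - d N)); last first.
  by apply/funext => N; rewrite /d subKr.
have zr1 i : `|z 0 i - x 0 i| < r1 by exact: lt_le_trans (zr' i) rr1.
have zr2 i : `|z 0 i - x 0 i| < r2 by exact: lt_le_trans (zr' i) rr2.
have fgz : box_sum a (z - x) N * box_sum b (z - x) N @[N --> \oo] --> f z * g z.
  exact: cvgM (fa z zr1) (gb z zr2).
rewrite -[X in _ --> X]/(f z * g z) -[f z * g z]subr0.
exact: cvgB fgz d0.
Qed.

End PowerSeries.

Section HolomorphicRing.
Variables (R : realType) (n : nat) (x : 'rV[Cplx R]_n).
Local Notation C := (Cplx R).

Definition holomorphic_pred : {pred ('rV[C]_n -> C)} :=
  [pred f | `[< holomorphic_at x f >]].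

Lemma holomorphic_predP f :
  reflect (holomorphic_at x f) (f \in holomorphic_pred).
Proof. exact: asboolP. Qed.

Lemma holomorphic_subring_closed : subring_closed holomorphic_pred.
Proof.
split=> [|f g /holomorphic_predP hf /holomorphic_predP hg|
          f g /holomorphic_predP hf /holomorphic_predP hg];
  apply/holomorphic_predP.
- exact: holomorphic_at_cst.
- by apply: (holomorphic_atD hf); exact: holomorphic_atN.
- exact: holomorphic_atM.
Qed.

HB.instance Definition _ := GRing.isSubringClosed.Build _ holomorphic_pred
  holomorphic_subring_closed.

(* The ring of the functions that are holomorphic at x.  Two of its elements
   may have the same germ at x; germ_ring below identifies such functions. *)
Record hol_fun := HolFun {
  hol_val :> 'rV[C]_n -> C;
  _ : hol_val \in holomorphic_pred }.

HB.instance Definition _ := [isSub for hol_val].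
HB.instance Definition _ := [Choice of hol_fun by <:].
HB.instance Definition _ := [SubChoice_isSubComNzRing of hol_fun by <:].

Lemma hol_funP (f : hol_fun) : holomorphic_at x f.
Proof. by apply/holomorphic_predP; exact: valP. Qed.

End HolomorphicRing.

(* (X, x) in (C^n, x): the germ at base of the set locus, which near base is
   the set of common zeros of finitely many holomorphic functions *)
Record germ (R : realType) (n : nat) := Germ {
  base : 'rV[Cplx R]_n;
  locus : set 'rV[Cplx R]_n;
  base_locus : locus base;
  locus_analytic : exists s : seq (hol_fun base),
    \forall z \near base, locus z <-> (forall f, f \in s -> f z = 0) }.

Section LocalRing.
Variables (R : realType) (n : nat) (X : germ R n).
Local Notation C := (Cplx R).

Definition vanishing : {pred hol_fun (base X)} :=
  [pred f : hol_fun (base X) |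
    `[< \forall z \near base X, locus X z -> f z = 0 >]].

Lemma vanishingP (f : hol_fun (base X)) :
  reflect (\forall z \near base X, locus X z -> f z = 0) (f \in vanishing).
Proof. exact: asboolP. Qed.

Lemma vanishing_idealr : idealr_closed vanishing.
Proof.
split=> [||f g h /vanishingP g0 /vanishingP h0].
- by apply/vanishingP; near=> z.
- apply: (introN idP) => /vanishingP/nbhs_singleton/(_ (base_locus X)) /eqP.
  by rewrite oner_eq0.
- apply/vanishingP; apply: filterS2 g0 h0 => z g0 h0 Xz.
  by rewrite -[LHS]/(f z * g z + h z) g0// h0// mulr0 addr0.
Unshelve. all: by end_near. Qed.

HB.instance Definition _ := isIdealr.Build _ vanishing vanishing_idealr.

(* O_(X,x) = O_(C^n,x) / I_(X,x) *)
Definition germ_ring : comNzRingType := {ideal_quot vanishing}.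

Definition germ_class (f : hol_fun (base X)) : germ_ring :=
  \pi_{ideal_quot vanishing} f.

Definition germ_repr (s : germ_ring) : hol_fun (base X) :=
  repr (s : {ideal_quot vanishing}).

Lemma germ_reprK s : germ_class (germ_repr s) = s.
Proof. exact: reprK. Qed.

Lemma germ_classP (f g : hol_fun (base X)) :
  germ_class f = germ_class g <->
  \forall z \near base X, locus X z -> f z = g z.
Proof.
have fg z : ((f - g : hol_fun _) z = 0) <-> f z = g z.
  rewrite -[(f - g : hol_fun _) z]/(f z - g z).
  by split=> [/eqP|->]; rewrite ?subrr// subr_eq0 => /eqP.
split=> [/eqP|h].
  rewrite -Quotient.idealrBE => /vanishingP; apply: filterS => z h Xz.
  exact/fg/h.
apply/eqP; rewrite -Quotient.idealrBE; apply/vanishingP.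
by apply: filterS h => z h Xz; exact/fg/h.
Qed.

Lemma germ_class_zmod : zmod_morphism germ_class.
Proof. exact: rmorphB. Qed.

Lemma germ_class_monoid : monoid_morphism germ_class.
Proof. by split; [exact: rmorph1|exact: rmorphM]. Qed.

HB.instance Definition _ := GRing.isZmodMorphism.Build
  (hol_fun (base X)) germ_ring germ_class germ_class_zmod.
HB.instance Definition _ := GRing.isMonoidMorphism.Build
  (hol_fun (base X)) germ_ring germ_class germ_class_monoid.

Definition residue (s : germ_ring) : C := germ_repr s (base X).

Lemma residueE f : residue (germ_class f) = f (base X).
Proof.
have /germ_classP/nbhs_singleton h := germ_reprK (germ_class f).
exact/h/base_locus.
Qed.

Lemma residue_zmod : zmod_morphism residue.
Proof.
move=> s t; rewrite -[s]germ_reprK -[t]germ_reprK -rmorphB.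
by rewrite !residueE.
Qed.

Lemma residue_monoid : monoid_morphism residue.
Proof.
split=> [|s t]; first by rewrite -(rmorph1 germ_class) residueE.
by rewrite -[s]germ_reprK -[t]germ_reprK -rmorphM !residueE.
Qed.

HB.instance Definition _ :=
  GRing.isZmodMorphism.Build germ_ring C residue residue_zmod.
HB.instance Definition _ :=
  GRing.isMonoidMorphism.Build germ_ring C residue residue_monoid.

End LocalRing.

(* A morphism (Z,z) -> (X,x): a germ at z of a continuous map Z -> X along
   which holomorphic germs on X pull back to holomorphic germs on Z.  Applied
   to the coordinate functions, mor_hol says that the components of the map
   are, on Z, restrictions of holomorphic functions. *)
Record germ_morphism (R : realType) (l n : nat) (Z : germ R l) (X : germ R n) :=
  GermMorphism {
    mor_map :> 'rV[Cplx R]_l -> 'rV[Cplx R]_n;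
    mor_base : mor_map (base Z) = base X;
    mor_locus : \forall u \near base Z, locus Z u -> locus X (mor_map u);
    mor_cont : mor_map u @[u --> within (locus Z) (nbhs (base Z))] --> base X;
    mor_hol : forall f : hol_fun (base X), exists h : hol_fun (base Z),
      \forall u \near base Z, locus Z u -> h u = f (mor_map u) }.

Section Pullback.
Variables (R : realType) (l n : nat) (Z : germ R l) (X : germ R n).
Variable a : germ_morphism Z X.

Definition pullback (s : germ_ring X) : germ_ring Z :=
  germ_class (projT1 (cid (mor_hol a (germ_repr s)))).

Lemma pullbackE (f : hol_fun (base X)) (h : hol_fun (base Z)) :
  (\forall u \near base Z, locus Z u -> h u = f (a u)) ->
  pullback (germ_class f) = germ_class h.
Proof.
move=> hf; rewrite /pullback; case: cid => g /= gf; apply/germ_classP.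
have /germ_classP/(mor_cont a) ff := germ_reprK (germ_class f).
apply: filterS3 (filterI hf gf) (mor_locus a) ff => u [hu gu] Xu fu Zu.
by rewrite gu// hu// fu//; exact: Xu.
Qed.

Lemma pullback_zmod : zmod_morphism pullback.
Proof.
move=> s t; rewrite -[s]germ_reprK -[t]germ_reprK -rmorphB.
have [h hs] := mor_hol a (germ_repr s); have [k kt] := mor_hol a (germ_repr t).
rewrite (pullbackE hs) (pullbackE kt) -rmorphB; apply: pullbackE.
apply: filterS2 hs kt => u hs kt Zu.
by rewrite -[LHS]/(h u - k u) hs// kt.
Qed.

Lemma pullback_monoid : monoid_morphism pullback.
Proof.
split=> [|s t].
  rewrite -(rmorph1 (@germ_class _ _ X)) -(rmorph1 (@germ_class _ _ Z)).
  by apply: pullbackE; near=> u.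
rewrite -[s]germ_reprK -[t]germ_reprK -rmorphM.
have [h hs] := mor_hol a (germ_repr s); have [k kt] := mor_hol a (germ_repr t).
rewrite (pullbackE hs) (pullbackE kt) -rmorphM; apply: pullbackE.
apply: filterS2 hs kt => u hs kt Zu.
by rewrite -[LHS]/(h u * k u) hs// kt.
Unshelve. all: by end_near. Qed.

HB.instance Definition _ := GRing.isZmodMorphism.Build
  (germ_ring X) (germ_ring Z) pullback pullback_zmod.
HB.instance Definition _ := GRing.isMonoidMorphism.Build
  (germ_ring X) (germ_ring Z) pullback pullback_monoid.

End Pullback.

Section FiberProduct.
Variables (A B S : comNzRingType).
Variables (f : {rmorphism A -> S}) (g : {rmorphism B -> S}).

Definition fiber_pred : {pred A * B} := [pred p | f p.1 == g p.2].

Lemma fiber_subring_closed : subring_closed fiber_pred.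
Proof.
split=> [|p q|p q]; rewrite !inE ?rmorph1// => /eqP ep /eqP eq.
  by rewrite !rmorphB ep eq.
by rewrite !rmorphM ep eq.
Qed.

HB.instance Definition _ :=
  GRing.isSubringClosed.Build _ fiber_pred fiber_subring_closed.

Record fiber_product := FiberProduct {
  fiber_val :> A * B; _ : fiber_val \in fiber_pred }.

HB.instance Definition _ := [isSub for fiber_val].
HB.instance Definition _ := [Choice of fiber_product by <:].
HB.instance Definition _ := [SubChoice_isSubComNzRing of fiber_product by <:].

Definition fiber_fst (p : fiber_product) : A := p.1.
Definition fiber_snd (p : fiber_product) : B := p.2.

Lemma fiber_fst_zmod : zmod_morphism fiber_fst. Proof. by []. Qed.
Lemma fiber_fst_monoid : monoid_morphism fiber_fst. Proof. by []. Qed.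
Lemma fiber_snd_zmod : zmod_morphism fiber_snd. Proof. by []. Qed.
Lemma fiber_snd_monoid : monoid_morphism fiber_snd. Proof. by []. Qed.

HB.instance Definition _ :=
  GRing.isZmodMorphism.Build fiber_product A fiber_fst fiber_fst_zmod.
HB.instance Definition _ :=
  GRing.isMonoidMorphism.Build fiber_product A fiber_fst fiber_fst_monoid.
HB.instance Definition _ :=
  GRing.isZmodMorphism.Build fiber_product B fiber_snd fiber_snd_zmod.
HB.instance Definition _ :=
  GRing.isMonoidMorphism.Build fiber_product B fiber_snd fiber_snd_monoid.

End FiberProduct.

Definition restrict_scalars (A B : comNzRingType) (phi : {rmorphism A -> B}) :
  Type := B.

Section RestrictScalars.
Variables (A B : comNzRingType) (phi : {rmorphism A -> B}).
Local Notation M := (restrict_scalars phi).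

HB.instance Definition _ := GRing.Zmodule.copy M B.

Definition restrict_scale (a : A) (v : M) : M := (phi a * (v : B) : B).

Fact restrict_scaleA a b v :
  restrict_scale a (restrict_scale b v) = restrict_scale (a * b) v.
Proof. by rewrite /restrict_scale rmorphM mulrA. Qed.
Fact restrict_scale1 : left_id 1 restrict_scale.
Proof. by move=> v; rewrite /restrict_scale rmorph1 mul1r. Qed.
Fact restrict_scaleDr : right_distributive restrict_scale +%R.
Proof. by move=> a u v; exact: mulrDr. Qed.
Fact restrict_scaleDl v : {morph restrict_scale^~ v : a b / a + b}.
Proof. by move=> a b; rewrite /restrict_scale rmorphD; exact: mulrDl. Qed.

HB.instance Definition _ := GRing.Zmodule_isLmodule.Build A M
  restrict_scaleA restrict_scale1 restrict_scaleDr restrict_scaleDl.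

End RestrictScalars.

(* ... -> A^(rank 1) -> A^(rank 0) -> M -> 0, acting on row vectors *)
Record free_resolution (A : comNzRingType) (M : lmodType A) := FreeResolution {
  res_rank : nat -> nat;
  res_diff : forall i, 'M[A]_(res_rank i.+1, res_rank i);
  res_aug : {linear 'rV[A]_(res_rank 0%N) -> M};
  res_aug_surj : forall m, exists v, res_aug v = m;
  res_exact0 : forall v,
    res_aug v = 0 <-> exists w, v = w *m res_diff 0%N;
  res_exact : forall i (v : 'rV_(res_rank i.+1)),
    v *m res_diff i = 0 <-> exists w, v = w *m res_diff i.+1 }.

Section Betti.
Variables (A : comNzRingType) (K : fieldType) (ev : {rmorphism A -> K}).

(* The dimension over K of the i-th homology (kernel modulo image) of F (x)_A K,
   where K is an A-module through ev: A^r (x)_A K = K^r, and the differentials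
   of F (x)_A K are the images under ev of those of F. *)
Definition tor_dim (M : lmodType A) (F : free_resolution M) (i : nat) : nat :=
  let d j := map_mx ev (res_diff F j) in
  match i with
  | 0 => res_rank F 0 - \rank (d 0)
  | j.+1 => \rank (kermx (d j)) - \rank (d j.+1)
  end%N.

(* dim_K Tor_i^A(M, K), computed from a resolution of M by free modules of
   finite rank.  Such a resolution exists when A is noetherian and M is finitely
   generated, and the dimension does not depend on it; the default value 0 is
   used only if there is none. *)
Definition betti (M : lmodType A) (i : nat) : nat :=
  xget 0%N [set k | exists F : free_resolution M, k = tor_dim F i].

Definition alg_betti (B : comNzRingType) (phi : {rmorphism A -> B}) (i : nat) :
  nat := betti (restrict_scalars phi) i.

(* A power series in t is represented by its sequence of coefficients. *)
Definition poincare (B : comNzRingType) (phi : {rmorphism A -> B}) :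
  nat -> nat := alg_betti phi.

End Betti.

Definition series_mul (p q : nat -> nat) (i : nat) : nat :=
  (\sum_(j < i.+1) p j * q (i - j))%N.

Definition radical (A : comNzRingType) (I : {pred A}) : Prop :=
  forall (a : A) (k : nat), a ^+ k \in I -> a \in I.

(* For A = O_(X,x) and I radical, the quotient is the local ring of the subspace
   (W,w) defined by I.  An idealr is a proper ideal, i.e., w belongs to W. *)
Definition quotient_map (A : comNzRingType) (I : idealr A) :
  {rmorphism A -> {ideal_quot I}} := \pi_{ideal_quot I}.

(* phi is the ring morphism O_(X',x') -> O_(Y',y') of a morphism of germs
   (Y',y') -> (X',x'), and evA, evB are the residue maps.  The quotient B / I is
   an A-module along phi. *)
Definition large (A B : comNzRingType) (K : fieldType)
    (evA : {rmorphism A -> K}) (evB : {rmorphism B -> K})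
    (phi : {rmorphism A -> B}) : Prop :=
  forall I : idealr B, radical I ->
    poincare evA (quotient_map I \o phi) =1
    series_mul (poincare evB (quotient_map I)) (poincare evA phi).

Section Gluing.
Variables (R : realType) (n m l : nat).
Variables (X : germ R n) (Y : germ R m) (Z : germ R l).
Variables (alpha : germ_morphism Z X) (beta : germ_morphism Z Y).

(* The local ring of the pushout of alpha and beta, on which X and Y are subspaces
   through glue_fst and glue_snd. *)
Definition glue_ring : comNzRingType :=
  fiber_product (pullback alpha) (pullback beta).

Definition glue_fst : {rmorphism glue_ring -> germ_ring X} :=
  @fiber_fst _ _ _ (pullback alpha) (pullback beta).
Definition glue_snd : {rmorphism glue_ring -> germ_ring Y} :=
  @fiber_snd _ _ _ (pullback alpha) (pullback beta).

Definition glue_residue : {rmorphism glue_ring -> Cplx R} :=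
  @residue _ _ X \o glue_fst.

Definition large_gluing : Prop := large glue_residue (@residue _ _ X) glue_fst.

End Gluing.

(* Main.v *)
Require Import Defs.
From HB Require Import structures.
From mathcomp Require Import all_boot all_order all_algebra complex.
From mathcomp Require Import all_classical reals topology normedtype sequences.
From mathcomp Require Import zify ring lra.

(* Write P^A_M for the Poincare series of M over A, and O_V = O_X x_(O_Z) O_Y.
   The kernel of O_V -> O_Z is the direct sum of the kernels of O_V -> O_X and
   O_V -> O_Y, so P^V_Z + 1 = P^V_X + P^V_Y.  Largeness at the subspace Z gives
   P^V_Z = P^X_Z P^V_X, which determines the first coefficients of P^V_X; then
   P^V_W = P^X_W P^V_X, and the three formulas are its coefficients.  Division by
   beta_1^X(Z) is harmless because, by Nakayama, it vanishes only if alpha^* is an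
   isomorphism.  Betti numbers are read off resolutions, whose existence needs
   O_X to be noetherian: the exponents of the lexicographically least terms of an
   ideal are dominated by finitely many of them (Dickson), and dividing by the
   corresponding elements leaves no remainder; the division algorithm converges
   in a weighted l^1 norm in which those least terms dominate. *)

Set Implicit Arguments.
Unset Strict Implicit.
Unset Printing Implicit Defensive.

Import Order.TTheory GRing.Theory Num.Theory.
Local Open Scope ring_scope.

(** * Betti numbers and resolutions *)

(** For an ideal I inside the maximal ideal, Tor_(i+1)(A/I, C) is Tor_i(I, C), and Tor is additive
    on direct sums of ideals; the coefficients of degree 0 all equal 1, which is the origin of the
    correcting 1. With largeness the identity becomes P^V_Y - 1 = (P^X_Z - 1) P^V_X, so that in each
    degree the highest unknown coefficient cancels. The obstacle to noetherianity is convergence. A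
    lexicographically least term may have high total degree and need not dominate on any polydisc
    with equal radii. With radii 2^-(K^(n-i)), one extra power of an early variable shrinks a term
    by more than the missing later powers can enlarge it. How large K must be depends on the
    dividend and the divisors, which is harmless because Dickson's lemma leaves only finitely many
    divisors. *)

Lemma quotient_rank_le (K : fieldType) (p q u b u' b' : nat)
    (U : 'M[K]_(u, p)) (B : 'M_(b, p)) (U' : 'M_(u', q)) (B' : 'M_(b', q))
    (f : 'M_(p, q)) :
  (U *m f <= U')%MS -> (B' <= U')%MS ->
  (forall v : 'rV_p, (v <= U)%MS -> (v *m f <= B')%MS -> (v <= B)%MS) ->
  (\rank U - \rank B <= \rank U' - \rank B')%N.
Proof.
move=> UfU' B'U' inj.
(* Multiplication by [cokermx B'] is the passage to the quotient by B'. The kernel of U -> U'/B'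
   lies in B by [inj], hence rank U is at most dim U'/B' plus rank B. *)
have keq r (W : 'M_(r, q)) : \rank W =
    (\rank (W *m cokermx B') + \rank (W :&: B')%MS)%N.
  rewrite -(mxrank_mul_ker W (cokermx B')); congr (_ + _)%N.
  apply: eqmx_rank.
  have kB : (kermx (cokermx B') == B')%MS.
    by apply/andP; split; [rewrite submxE mulmx_ker|apply/sub_kermxP; exact: mulmx_coker].
  by case/andP: kB => kB Bk; rewrite !capmxS.
have -> : (\rank U' - \rank B')%N = \rank (U' *m cokermx B').
  rewrite (keq _ U'); have -> : \rank (U' :&: B')%MS = \rank B'.
    by apply: eqmx_rank; rewrite capmxSr sub_capmx B'U' submx_refl.
  by rewrite addnK.
rewrite leq_subLR -(mxrank_mul_ker U (f *m cokermx B')) addnC; apply: leq_add.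
  apply: mxrankS; apply/row_subP => i; apply: inj.
    by rewrite (submx_trans (row_sub _ _))// capmxSl.
  rewrite submxE -mulmxA; apply/eqP/sub_kermxP.
  by rewrite (submx_trans (row_sub _ _))// capmxSr.
by apply: mxrankS; rewrite mulmxA submxMr.
Qed.

Section Resolutions.
Variable A : comNzRingType.

Lemma lift_rows p q r t (d : 'M[A]_(q, r)) (d' : 'M_(p, q)) (m : 'M_(t, q)) :
  (forall v : 'rV_q, v *m d = 0 -> exists w, v = w *m d') ->
  m *m d = 0 -> exists w, m = w *m d'.
Proof.
move=> ex md0.
have /choice[w hw] : forall i, exists w, row i m = w *m d'.
  by move=> i; apply: ex; rewrite -row_mul md0 row0.
exists (\matrix_i w i); apply/row_matrixP => i.
by rewrite hw row_mul rowK.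
Qed.

Section Comparison.
Variable M : lmodType A.
Implicit Types F G : free_resolution M.

Lemma res_diff_comp F i : res_diff F i.+1 *m res_diff F i = 0.
Proof.
apply/row_matrixP => j; rewrite row0 row_mul.
by apply/(res_exact (f := F)); exists (delta_mx 0 j); rewrite -rowE.
Qed.

Lemma res_aug_diff F v : res_aug F (v *m res_diff F 0%N) = 0.
Proof. by apply/(res_exact0 (f := F)); exists v. Qed.

Lemma lift_res F i t (m : 'M_(t, _)) :
  m *m res_diff F i = 0 -> exists w, m = w *m res_diff F i.+1.
Proof. by apply: lift_rows => v /(res_exact (f := F)). Qed.

Lemma lift_res0 F t (m : 'M_(t, _)) :
  (forall i, res_aug F (row i m) = 0) -> exists w, m = w *m res_diff F 0%N.
Proof.
move=> m0; have /choice[w hw] : forall i, exists w, row i m = w *m res_diff F 0%N.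
  by move=> i; apply/(res_exact0 (f := F)).
exists (\matrix_i w i); apply/row_matrixP => i.
by rewrite hw row_mul rowK.
Qed.

Definition chain_map F G (f : forall i, 'M[A]_(res_rank F i, res_rank G i)) :=
  (forall v, res_aug G (v *m f 0%N) = res_aug F v) /\
  (forall i, f i.+1 *m res_diff G i = res_diff F i *m f i).

Lemma aug_rows F G t (m : 'M_(t, res_rank F 0)) (n : 'M_(t, res_rank G 0)) :
  (forall i, res_aug F (row i m) = res_aug G (row i n)) ->
  forall v, res_aug F (v *m m) = res_aug G (v *m n).
Proof.
move=> h v; rewrite (row_sum_delta v) !mulmx_suml !linear_sum.
by apply: eq_bigr => i _; rewrite -!scalemxAl !linearZ -!rowE /= h.
Qed.

Lemma chain_map_exists F G : exists f, @chain_map F G f.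
Proof.
have /choice[p hp] : forall i, exists v, res_aug G v = res_aug F (delta_mx 0 i).
  by move=> i; exact: res_aug_surj.
pose f0 := \matrix_i p i.
have f0E v : res_aug G (v *m f0) = res_aug F v.
  rewrite -[v in RHS]mulmx1; apply: aug_rows => i.
  by rewrite rowK hp row1.
(* Two consecutive components are kept together with their commuting square, because the square is
   what allows the next component to be lifted. *)
pose state i := {c : 'M[A]_(res_rank F i, res_rank G i) *
  'M[A]_(res_rank F i.+1, res_rank G i.+1) |
  c.2 *m res_diff G i = res_diff F i *m c.1}.
have s0 : {s : state 0%N | (sval s).1 = f0}.
  apply: cid.
  have [|f1 hf1] := @lift_res0 G _ (res_diff F 0%N *m f0).
    by move=> i; rewrite row_mul f0E rowE res_aug_diff.
  have e : (f0, f1).2 *m res_diff G 0%N = res_diff F 0%N *m (f0, f1).1 by [].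
  by exists (exist _ (f0, f1) e).
have next i (s : state i) : {s' : state i.+1 | (sval s').1 = (sval s).2}.
  apply: cid; case: s => -[c1 c2] /= e.
  have [|c3 hc3] := @lift_res G i _ (res_diff F i.+1 *m c2).
    by rewrite -mulmxA e mulmxA res_diff_comp mul0mx.
  have e' : (c2, c3).2 *m res_diff G i.+1 = res_diff F i.+1 *m (c2, c3).1 by [].
  by exists (exist _ (c2, c3) e').
pose st := fix st i : state i :=
  match i with 0%N => sval s0 | j.+1 => sval (next j (st j)) end.
exists (fun i => (sval (st i)).1); split=> [v|i].
  by rewrite (svalP s0).
by rewrite /= (svalP (next i (st i))) (svalP (st i)).
Qed.

(** Chain maps lifting zero are null-homotopic. The homotopy is stated degree by degree, which is
    all that homology in one degree uses. *)
Lemma chain_map_null F (e : forall i, 'M_(res_rank F i, res_rank F i)) :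
  (forall v, res_aug F (v *m e 0%N) = 0) ->
  (forall i, e i.+1 *m res_diff F i = res_diff F i *m e i) ->
  (exists h, e 0%N = h *m res_diff F 0%N) /\
  forall i, exists h h', e i.+1 = res_diff F i *m h + h' *m res_diff F i.+1.
Proof.
move=> e0 eS.
have [|h0 h0E] := @lift_res0 F _ (e 0%N); first by move=> i; rewrite rowE e0.
split=> [|i]; first by exists h0.
have step j h : res_diff F j *m h *m res_diff F j = res_diff F j *m e j ->
    exists h', e j.+1 = res_diff F j *m h + h' *m res_diff F j.+1.
  move=> hE; have [|h' h'E] := @lift_res F j _ (e j.+1 - res_diff F j *m h).
    by rewrite mulmxBl eS hE subrr.
  by exists h'; rewrite -h'E addrC subrK.
(* The equation carried through the induction says that the rows of [e i.+1 - d h] are cycles;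
   exactness turns them into boundaries. *)
suff [h hE] : exists h, res_diff F i *m h *m res_diff F i = res_diff F i *m e i.
  by have [h' h'E] := step i h hE; exists h, h'.
elim: i => [|i [h hE]]; first by exists h0; rewrite h0E mulmxA.
have [h' h'E] := step i h hE; exists h'.
by rewrite h'E mulmxDr !mulmxA res_diff_comp mul0mx add0r.
Qed.

Section TorDim.
Variables (K : fieldType) (ev : {rmorphism A -> K}).

(** A comparison map F -> G followed by one back is homotopic to the identity, so F -> G is
    injective on homology after base change to K. Exchanging F and G makes the inequality an
    equality. *)
Lemma tor_dim_le F G i : (tor_dim ev F i <= tor_dim ev G i)%N.
Proof.
have [f [f0 fS]] := chain_map_exists F G.
have [g [g0 gS]] := chain_map_exists G F.
pose e i : 'M_(res_rank F i, res_rank F i) := f i *m g i - 1%:M.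
have [||[h0 h0E] eS] := @chain_map_null F e.
- by move=> v; rewrite mulmxBr mulmx1 linearB /= mulmxA g0 f0 subrr.
- by move=> j; rewrite mulmxBl mulmxBr mul1mx mulmx1 -mulmxA gS !mulmxA fS.
have {}h0E : f 0%N *m g 0%N = 1%:M + h0 *m res_diff F 0%N.
  by rewrite -h0E addrC subrK.
case: i => [|j] /=.
  have := @quotient_rank_le _ _ _ _ _ _ _ 1%:M
    (map_mx ev (res_diff F 0%N)) 1%:M (map_mx ev (res_diff G 0%N)) (map_mx ev (f 0%N)).
  rewrite !mxrank1; apply; rewrite ?submx1// => v _ /submxP[w vE].
  have : v *m map_mx ev (f 0%N) *m map_mx ev (g 0%N) =
      v + v *m map_mx ev h0 *m map_mx ev (res_diff F 0%N).
    by rewrite -!mulmxA -!map_mxM h0E map_mxD mulmxDr map_mx1 mulmx1.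
  rewrite vE -mulmxA -map_mxM -gS map_mxM => /eqP.
  rewrite -subr_eq => /eqP <-.
  by rewrite mulmxA -mulmxBl submxMl.
have [h [h' hE]] := eS j.
have {}hE : f j.+1 *m g j.+1 =
    1%:M + (res_diff F j *m h + h' *m res_diff F j.+1).
  by rewrite -hE addrC subrK.
apply: (quotient_rank_le (f := map_mx ev (f j.+1))).
- apply/sub_kermxP; rewrite -mulmxA -map_mxM fS map_mxM mulmxA.
  by rewrite mulmx_ker mul0mx.
- by apply/sub_kermxP; rewrite -map_mxM res_diff_comp map_mx0.
move=> v /sub_kermxP vd /submxP[w vE].
have : v *m map_mx ev (f j.+1) *m map_mx ev (g j.+1) =
    v + v *m map_mx ev h' *m map_mx ev (res_diff F j.+1).
  rewrite -!mulmxA -!map_mxM hE !map_mxD mulmxDr map_mx1 mulmx1.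
  by rewrite !map_mxM mulmxDr mulmxA vd mul0mx add0r.
rewrite vE -mulmxA -map_mxM -gS map_mxM => /eqP.
rewrite -subr_eq => /eqP <-.
by rewrite mulmxA -mulmxBl submxMl.
Qed.

Lemma bettiE F i : betti ev M i = tor_dim ev F i.
Proof.
rewrite /betti; case: xgetP => [k _ [G ->]|/(_ (tor_dim ev F i))[]].
  by apply/eqP; rewrite eqn_leq !tor_dim_le.
by exists F.
Qed.

End TorDim.
End Comparison.
End Resolutions.

(** * Noetherian rings and resolutions by syzygies *)

Definition is_ideal (A : nzRingType) (I : A -> Prop) : Prop :=
  [/\ I 0, forall a b, I a -> I b -> I (a + b) & forall c a, I a -> I (c * a)].

Definition noetherian (A : nzRingType) : Prop :=
  forall I : A -> Prop, is_ideal I -> exists p (g : 'cV[A]_p),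
    (forall i, I (g i 0)) /\ forall a, I a -> exists w : 'rV_p, a = (w *m g) 0 0.

Lemma mx11P (T : Type) (a b : 'M[T]_1) : a 0 0 = b 0 0 -> a = b.
Proof. by move=> ab; apply/matrixP => i j; rewrite !ord1. Qed.

Lemma ideal_sum (A : nzRingType) (I : A -> Prop) p (w : 'I_p -> A) (g : 'I_p -> A) :
  is_ideal I -> (forall i, I (g i)) -> I (\sum_i w i * g i).
Proof.
case=> I0 ID IM Ig; elim/big_ind: _ => [//|x y Ix Iy|i _]; [exact: ID|exact: IM].
Qed.

Lemma ideal_mulmx (A : nzRingType) (I : A -> Prop) p (w : 'rV_p) (g : 'cV[A]_p) :
  is_ideal I -> (forall i, I (g i 0)) -> I ((w *m g) 0 0).
Proof. by move=> idI Ig; rewrite mxE; apply: ideal_sum. Qed.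

Section Noetherian.
Variable A : comNzRingType.
Hypothesis noethA : noetherian A.

(** Induction on the rank. The first coordinates of U form an ideal; lifts to U of its generators,
    together with generators of the submodule U' of vectors with first coordinate 0, generate U. *)
Lemma noetherian_submodule r (U : 'rV[A]_r -> Prop) :
  U 0 -> (forall u v, U u -> U v -> U (u + v)) -> (forall a v, U v -> U (a *: v)) ->
  exists p (G : 'M_(p, r)), forall v, U v <-> exists w, v = w *m G.
Proof.
have sumU s (V : 'rV[A]_s -> Prop) p (w : 'rV_p) (G : 'M_(p, s)) :
    V 0 -> (forall u v, V u -> V v -> V (u + v)) -> (forall a v, V v -> V (a *: v)) ->
    (forall i, V (row i G)) -> V (w *m G).
  move=> V0 VD VZ VG; rewrite mulmx_sum_row.
  by elim/big_ind: _ => // i _; exact: VZ.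
elim: r U => [|r IHr] U U0 UD UZ.
  exists 0%N, 0 => v; split=> [_|_]; first by exists 0; rewrite mul0mx thinmx0.
  by rewrite thinmx0.
pose I a := exists v, U v /\ v 0 0 = a.
have idI : is_ideal I.
  split; first by (exists 0; rewrite mxE).
    move=> a b [u [Uu <-]] [v [Uv <-]]; exists (u + v).
    by rewrite mxE; split; first exact: UD.
  by move=> c a [u [Uu <-]]; exists (c *: u); rewrite mxE; split; first exact: UZ.
have [p [g [Ig gen]]] := noethA idI.
have [h hP] := choice Ig.
pose U' (v : 'rV_r) := U (row_mx (0 : 'rV_1) v : 'rV_(1 + r)).
have [||| p' [G' G'P]] := IHr U'.
- by rewrite /U' row_mx0.
- by move=> u v Uu Uv; rewrite /U' -[0]add0r -add_row_mx; exact: UD.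
- by move=> a v Uv; rewrite /U' -(scaler0 _ a) -scale_row_mx; exact: UZ.
pose H : 'M_(p, 1 + r) := \matrix_i h i.
pose G : 'M_(p + p', 1 + r) := col_mx H (row_mx 0 G').
have GE (w : 'rV_p) (w' : 'rV_p') :
    row_mx w w' *m G = w *m H + row_mx (0 : 'rV_1) (w' *m G').
  by rewrite mul_row_col mul_mx_row mulmx0.
have HU w : U (w *m H).
  by apply: (sumU _ U) => // i; rewrite rowK; case: (hP i).
exists (p + p')%N, G => v; split=> [Uv|[w ->]].
  have [|w vE] := gen (v 0 0); first by exists v.
  have UvH : U (v - w *m H) by apply: (UD _ _ Uv); rewrite -scaleN1r; exact: UZ.
  have lead0 : @lsubmx _ 1 1 r (v - w *m H) = 0.
    apply: mx11P; rewrite !mxE.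
    have -> : lshift r (0 : 'I_1) = 0 :> 'I_(1 + r) by apply/val_inj.
    rewrite vE mxE -sumrB big1// => i _.
    by rewrite !mxE; case: (hP i) => _ ->; rewrite subrr.
  have : U' (@rsubmx _ 1 1 r (v - w *m H)).
    by rewrite /U' -lead0 hsubmxK.
  move=> /G'P[w' w'E]; exists (row_mx w w').
  by rewrite GE -w'E -lead0 hsubmxK addrC subrK.
rewrite -[w]hsubmxK GE; apply: (UD _ _ (HU _)).
by apply/G'P; exists (rsubmx w).
Qed.

Lemma syzygy_exists p q (d : 'M[A]_(p, q)) :
  exists p' (d' : 'M_(p', p)), forall v : 'rV_p, v *m d = 0 <-> exists w, v = w *m d'.
Proof.
apply: (@noetherian_submodule p (fun v => v *m d = 0)).
- exact: mul0mx.
- by move=> u v u0 v0; rewrite mulmxDl u0 v0 addr0.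
- by move=> a v v0; rewrite -scalemxAl v0 scaler0.
Qed.

End Noetherian.

(* The data of a resolution ... -> A^(syz_rank 1) -> A^(syz_rank 0) -> A -> A/I. *)
Record syzygies (A : comNzRingType) (I : A -> Prop) := Syzygies {
  syz_rank : nat -> nat;
  syz_gen : 'cV[A]_(syz_rank 0);
  syz_diff : forall i, 'M[A]_(syz_rank i.+1, syz_rank i);
  syz_genP : forall a, I a <-> exists w : 'rV_(syz_rank 0), a = (w *m syz_gen) 0 0;
  syz_exact0 : forall w : 'rV_(syz_rank 0),
    w *m syz_gen = 0 <-> exists w', w = w' *m syz_diff 0;
  syz_exact : forall i (w : 'rV_(syz_rank i.+1)),
    w *m syz_diff i = 0 <-> exists w', w = w' *m syz_diff i.+1 }.

Lemma syzygies_exist (A : comNzRingType) (I : A -> Prop) :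
  noetherian A -> is_ideal I -> inhabited (syzygies I).
Proof.
move=> noethA idI; have [p [g [Ig gen]]] := noethA _ idI.
(* Matrices of all formats share one type, so that taking relations can be iterated. *)
pose mat := {pq : nat * nat & 'M[A]_(pq.1, pq.2)}.
have next (s : mat) : {p' : nat & {d : 'M[A]_(p', (tag s).1) |
    forall v : 'rV_(tag s).1, v *m tagged s = 0 <-> exists w, v = w *m d}}.
  have [p' /cid[d dP]] := cid (syzygy_exists noethA (tagged s)).
  by exists p', d.
pose nxt (s : mat) : mat :=
  existT (fun pq => 'M_(pq.1, pq.2)) (tag (next s), (tag s).1) (sval (tagged (next s))).
(* The exponent is [i.+1] because the column of generators is stored separately: [st 0] is already
   its matrix of relations. *)
pose st i : mat := iter i.+1 nxt (existT (fun pq => 'M_(pq.1, pq.2)) (p, 1%N) g).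
constructor; exists (fun i => (tag (st i)).2) g (fun i => tagged (st i)).
- move=> a; split=> [/gen//|[w ->]]; exact: ideal_mulmx.
- by move=> w; exact: (svalP (tagged (next _)) w).
- by move=> i w; exact: (svalP (tagged (next (st i))) w).
Qed.

(** * Betti numbers of cyclic modules *)

Section SyzygyResolution.
Variables (A B : comNzRingType) (phi : {rmorphism A -> B}).
Hypothesis phi_surj : forall b, exists a, phi a = b.
Variable I : A -> Prop.
Hypothesis kerphi : forall a, I a <-> phi a = 0.
Variable s : syzygies I.

Definition cyclic_aug (v : 'rV[A]_1) : restrict_scalars phi := phi (v 0 0).

Lemma cyclic_aug_linear : linear cyclic_aug.
Proof. by move=> a u v; rewrite /cyclic_aug !mxE rmorphD rmorphM. Qed.

HB.instance Definition _ := GRing.isLinear.Build A 'rV[A]_1 (restrict_scalars phi)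
  _ cyclic_aug cyclic_aug_linear.

Definition cyclic_rank i := if i is j.+1 then syz_rank s j else 1%N.

Definition cyclic_diff i : 'M[A]_(cyclic_rank i.+1, cyclic_rank i) :=
  match i with 0%N => syz_gen s | j.+1 => syz_diff s j end.

(** Since [ev] kills I, the generators become zero over K: Tor_0 is all of K, and Tor_1 is the whole
    cokernel of the first matrix of relations. *)
Lemma cyclic_resolution : exists F : free_resolution (restrict_scalars phi),
  forall (K : fieldType) (ev : {rmorphism A -> K}),
    (forall a, I a -> ev a = 0) ->
    [/\ tor_dim ev F 0%N = 1%N,
        tor_dim ev F 1%N = (syz_rank s 0 - \rank (map_mx ev (syz_diff s 0)))%N
      & forall i, tor_dim ev F i.+2 = (syz_rank s i.+1 -
          \rank (map_mx ev (syz_diff s i)) - \rank (map_mx ev (syz_diff s i.+1)))%N].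
Proof.
have aug_surj (m : restrict_scalars phi) : exists v, cyclic_aug v = m.
  have [a aE] := phi_surj m; exists a%:M.
  by rewrite /cyclic_aug mxE mulr1n.
have exact0 v : cyclic_aug v = 0 <-> exists w, v = w *m cyclic_diff 0%N.
  rewrite /cyclic_aug -kerphi syz_genP; split=> [[w wE]|[w ->]]; last by exists w.
  by exists w; exact: mx11P.
have exactS i (v : 'rV_(cyclic_rank i.+1)) :
    v *m cyclic_diff i = 0 <-> exists w, v = w *m cyclic_diff i.+1.
  by case: i v => [|i] v; [exact: syz_exact0|exact: syz_exact].
exists (@FreeResolution _ (restrict_scalars phi) cyclic_rank cyclic_diff cyclic_aug
  aug_surj exact0 exactS) => K ev evI.
have gen0 : map_mx ev (syz_gen s) = 0.
  apply/matrixP => i j; rewrite !mxE evI// syz_genP; exists (delta_mx 0 i).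
  by rewrite -rowE mxE ord1.
split=> [||i] /=; rewrite ?mxrank_ker ?gen0 ?mxrank0 ?subn0//.
Qed.

Section TorOne.
Variables (K : fieldType) (ev : {rmorphism A -> K}).
Hypothesis evI : forall a, I a -> ev a = 0.

Lemma betti_cyclic :
  [/\ alg_betti ev phi 0 = 1%N,
      alg_betti ev phi 1 = (syz_rank s 0 - \rank (map_mx ev (syz_diff s 0)))%N
    & forall i, alg_betti ev phi i.+2 = (syz_rank s i.+1 -
        \rank (map_mx ev (syz_diff s i)) - \rank (map_mx ev (syz_diff s i.+1)))%N].
Proof.
have [F /(_ _ _ evI)[F0 F1 F2]] := cyclic_resolution.
by split=> [||i]; rewrite /alg_betti (bettiE _ F).
Qed.

(* Nakayama, by the determinant trick: if Tor_1 vanishes then combinations of the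
   relations form a matrix of residue 1, whose determinant kills the generators. *)
Lemma nakayama_betti1 : (forall k, exists a, ev a = k) ->
  alg_betti ev phi 1 = 0%N -> exists u, ev u = 1 /\ forall a, I a -> u * a = 0.
Proof.
move=> ev_surj; have [_ -> _] := betti_cyclic => /eqP; rewrite subn_eq0 => full.
have /row_fullP[w wE] : row_full (map_mx ev (syz_diff s 0)).
  by rewrite /row_full eqn_leq rank_leq_col.
have [c cE] := choice ev_surj.
pose W := map_mx c w *m syz_diff s 0.
exists (\det W); split.
  rewrite -det_map_mx map_mxM -map_mx_comp (_ : map_mx (ev \o c) w = w).
    by rewrite wE det1.
  by apply/matrixP => i j; rewrite mxE /= cE.
move=> a /(syz_genP s)[v ->].
have Wg : W *m syz_gen s = 0.
  rewrite -mulmxA [X in _ *m X](_ : _ = 0) ?mulmx0//.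
  apply/row_matrixP => i; rewrite row0 row_mul; apply/(syz_exact0 (s := s)).
  by exists (delta_mx 0 i); rewrite -rowE.
have /matrixP/(_ 0 0) : \det W *: (v *m syz_gen s) = 0.
  by rewrite scalemxAr -mul_scalar_mx -mul_adj_mx -mulmxA Wg !mulmx0.
by rewrite !mxE.
Qed.

End TorOne.
End SyzygyResolution.

(** * Direct sums of ideals *)

Section SumOfIdeals.
Variables (A : comNzRingType) (I J L : A -> Prop).
Hypothesis LE : forall a, L a <-> exists b c, [/\ I b, J c & a = b + c].
Hypothesis IJ0 : forall a, I a -> J (- a) -> a = 0.
Variables (s : syzygies I) (t : syzygies J).

Definition sum_rank i := (syz_rank s i + syz_rank t i)%N.
Definition sum_diff i : 'M[A]_(sum_rank i.+1, sum_rank i) :=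
  block_mx (syz_diff s i) 0 0 (syz_diff t i).
Definition sum_gen : 'cV[A]_(sum_rank 0) := col_mx (syz_gen s) (syz_gen t).

Lemma sum_exact p q r p' q' r' (d : 'M[A]_(p, q)) (e : 'M_(q, r))
    (d' : 'M[A]_(p', q')) (e' : 'M_(q', r')) :
  (forall w : 'rV_q, w *m e = 0 <-> exists v, w = v *m d) ->
  (forall w : 'rV_q', w *m e' = 0 <-> exists v, w = v *m d') ->
  forall w : 'rV_(q + q'), w *m block_mx e 0 0 e' = 0 <->
    exists v, w = v *m block_mx d 0 0 d'.
Proof.
move=> ex ex' w; rewrite -[w]hsubmxK mul_row_block !mulmx0 addr0 add0r; split.
  move/eqP; rewrite row_mx_eq0 => /andP[/eqP/ex[v ->] /eqP/ex'[v' ->]].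
  by exists (row_mx v v'); rewrite mul_row_block !mulmx0 addr0 add0r.
case=> v; rewrite -[v]hsubmxK mul_row_block !mulmx0 addr0 add0r.
case/eq_row_mx => l r0; apply/eqP; rewrite row_mx_eq0; apply/andP.
by split; apply/eqP; [apply/ex; exists (lsubmx v)|apply/ex'; exists (rsubmx v)].
Qed.

(** The direct sum of the two resolutions: by [IJ0], a relation among the joint generators splits
    into one on each side. The definition is transparent because [betti_sum] computes with its block
    matrices. *)
Definition sum_syzygies : syzygies L.
Proof.
refine (@Syzygies _ _ sum_rank sum_gen sum_diff _ _ _).
- move=> a; rewrite LE; split=> [[b [c [/(syz_genP s)[v ->] /(syz_genP t)[w ->] ->]]]|[w ->]].
    by exists (row_mx v w); rewrite mul_row_col [RHS]mxE.
  exists ((lsubmx w *m syz_gen s) 0 0), ((rsubmx w *m syz_gen t) 0 0); split.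
  + by apply/(syz_genP s); exists (lsubmx w).
  + by apply/(syz_genP t); exists (rsubmx w).
  by rewrite -[w in LHS]hsubmxK mul_row_col mxE.
- move=> w; split=> [|[w' ->]].
    rewrite -{1}[w]hsubmxK mul_row_col => /matrixP/(_ 0 0); rewrite !mxE => /eqP.
    set x := \sum_j _; set y := \sum_j _; rewrite addr_eq0 => /eqP xy.
    have xE : x = (lsubmx w *m syz_gen s) 0 0 by rewrite mxE.
    have yE : y = (rsubmx w *m syz_gen t) 0 0 by rewrite mxE.
    have x0 : x = 0.
      apply: IJ0; first by apply/(syz_genP s); exists (lsubmx w).
      by rewrite xy opprK; apply/(syz_genP t); exists (rsubmx w).
    have /(syz_exact0 (s := s))[v vE] : lsubmx w *m syz_gen s = 0.
      by apply: mx11P; rewrite -xE x0 mxE.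
    have /(syz_exact0 (s := t))[v' v'E] : rsubmx w *m syz_gen t = 0.
      by apply: mx11P; rewrite -yE mxE -[y]opprK -xy x0 oppr0.
    by exists (row_mx v v'); rewrite -[w]hsubmxK vE v'E mul_row_block !mulmx0 addr0 add0r.
  rewrite -[w']hsubmxK mul_row_block !mulmx0 addr0 add0r mul_row_col.
  have -> : lsubmx w' *m syz_diff s 0 *m syz_gen s = 0.
    by apply/(syz_exact0 (s := s)); exists (lsubmx w').
  by rewrite add0r; apply/(syz_exact0 (s := t)); exists (rsubmx w').
- by move=> i w; apply: sum_exact; exact: syz_exact.
Defined.

Section SumBetti.
Variables (K : fieldType) (ev : {rmorphism A -> K}).

(** Betti numbers are truncated differences of ranks; this bound ensures that nothing is truncated,
    so that they can be added. *)
Lemma syz_rank_bound (N : A -> Prop) (u : syzygies N) i :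
  (\rank (map_mx ev (syz_diff u i)) + \rank (map_mx ev (syz_diff u i.+1))
    <= syz_rank u i.+1)%N.
Proof.
rewrite addnC; apply: mulmx0_rank_max; rewrite -map_mxM -[RHS](map_mx0 ev); congr map_mx.
apply/row_matrixP => j; rewrite row0 row_mul; apply/(syz_exact (s := u)).
by exists (delta_mx 0 j); rewrite -rowE.
Qed.

Variables (B C D : comNzRingType).
Variables (f : {rmorphism A -> B}) (g : {rmorphism A -> C}) (h : {rmorphism A -> D}).
Hypothesis f_surj : forall b, exists a, f a = b.
Hypothesis g_surj : forall c, exists a, g a = c.
Hypothesis h_surj : forall d, exists a, h a = d.
Hypothesis kerf : forall a, I a <-> f a = 0.
Hypothesis kerg : forall a, J a <-> g a = 0.
Hypothesis kerh : forall a, L a <-> h a = 0.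
Hypothesis evL : forall a, L a -> ev a = 0.

(** Ranks of block diagonal matrices add up. Degree 0 is excluded: there all three Betti numbers
    equal 1. *)
Lemma betti_sum i :
  alg_betti ev h i.+1 = (alg_betti ev f i.+1 + alg_betti ev g i.+1)%N.
Proof.
have J0 : J 0 by rewrite kerg rmorph0.
have I0 : I 0 by rewrite kerf rmorph0.
have evI a : I a -> ev a = 0 by move=> Ia; apply/evL/LE; exists a, 0; rewrite addr0.
have evJ a : J a -> ev a = 0 by move=> Ia; apply/evL/LE; exists 0, a; rewrite add0r.
have [_ f1 f2] := betti_cyclic f_surj kerf s evI.
have [_ g1 g2] := betti_cyclic g_surj kerg t evJ.
have [_ h1 h2] := betti_cyclic h_surj kerh sum_syzygies evL.
have dE j : \rank (map_mx ev (syz_diff sum_syzygies j)) =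
    (\rank (map_mx ev (syz_diff s j)) + \rank (map_mx ev (syz_diff t j)))%N.
  by rewrite /= map_block_mx !map_mx0 rank_diag_block_mx.
case: i => [|i]; rewrite ?h1 ?h2 ?f1 ?f2 ?g1 ?g2 !dE.
  have := rank_leq_col (map_mx ev (syz_diff s 0)).
  by have := rank_leq_col (map_mx ev (syz_diff t 0)); rewrite /= /sum_rank; lia.
have subD (p q a b c d : nat) : (a + b <= p -> c + d <= q ->
  p + q - (a + c) - (b + d) = p - a - b + (q - c - d))%N by lia.
by apply: subD; exact: syz_rank_bound.
Qed.

End SumBetti.
End SumOfIdeals.

(** * Multi-indices *)

Section MultiIndices.
Variable n : nat.
Implicit Types (e nu mu la : multi_index n) (E : multi_index n -> Prop).

Definition lex_lt e nu : Prop :=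
  exists i : 'I_n, (forall j : 'I_n, (j < i)%N -> e j = nu j) /\ (e i < nu i)%N.

Lemma nat_min (P : nat -> Prop) : (exists k, P k) ->
  exists k, P k /\ forall j, P j -> (k <= j)%N.
Proof.
move=> [k Pk]; have ex : exists k, `[< P k >] by exists k; apply/asboolP.
exists (ex_minn ex); case: ex_minnP => m /asboolP Pm min.
by split=> // j Pj; apply: min; apply/asboolP.
Qed.

(** Coordinates are minimised one after the other, each among the elements of E that agree with the
    previous choice on the earlier coordinates. *)
Lemma lex_min E : (exists nu, E nu) ->
  exists e, E e /\ forall nu, E nu -> nu = e \/ lex_lt e nu.
Proof.
move=> [nu0 Enu0].
have main k : (k <= n)%N -> exists e, E e /\ forall nu, E nu ->
    (forall j : 'I_n, (j < k)%N -> e j = nu j) \/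
    exists i : 'I_n, [/\ (i < k)%N, forall j : 'I_n, (j < i)%N -> e j = nu j & (e i < nu i)%N].
  elim: k => [_|k IHk kn]; first by exists nu0; split=> // mu _; left.
  have [e0 [Ee0 h0]] := IHk (ltnW kn).
  pose k' := Ordinal kn.
  have [|m [[e [Ee agree <-]] min]] := @nat_min (fun m =>
      exists nu, [/\ E nu, forall j : 'I_n, (j < k)%N -> e0 j = nu j & nu k' = m]).
    by exists (e0 k'), e0.
  exists e; split=> // nu Enu.
  have [eq|[i [ik eq lt]]] := h0 nu Enu; last first.
    right; exists i; split=> [|j ji|]; [exact: leqW| |by rewrite -agree].
    by rewrite -agree ?eq// (ltn_trans ji).
  have := min (nu k'); rewrite leq_eqVlt => /(_ _)/orP[|/eqP eqk|lt].
  - by exists nu.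
  - left=> j; rewrite ltnS leq_eqVlt => /orP[/eqP jk|jk].
      by have -> : j = k' by apply/val_inj.
    by rewrite -agree// eq.
  - by right; exists k'; split=> // j jk; rewrite -agree// eq.
have [e [Ee h]] := main n (leqnn n); exists e; split=> // nu /h[eq|[i [_ eq lt]]].
  by left; apply/ffunP => j; rewrite eq.
by right; exists i.
Qed.

Definition index_le e nu : bool := [forall i, e i <= nu i]%N.

Definition shift_index nu e : multi_index n := [ffun i => (nu i - e i)%N].

Lemma add_shift e nu : index_le e nu -> add_index (shift_index nu e) e = nu.
Proof. by move=> /forallP le; apply/ffunP => i; rewrite !ffunE subnK. Qed.

Lemma shift_add e mu : shift_index (add_index mu e) e = mu.
Proof. by apply/ffunP => i; rewrite !ffunE addnK. Qed.

Lemma le_add_index e mu : index_le e (add_index mu e).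
Proof. by apply/forallP => i; rewrite ffunE leq_addl. Qed.

(** Induction on the number of coordinates compared. If s dominates on the first k coordinates and N
    bounds the next coordinate on s, then s still dominates every index whose next coordinate is at
    least N. The others lie in the finitely many slices where that coordinate is a fixed c < N, and
    each slice has its own finite set. *)
Lemma dickson E : exists s : seq (multi_index n),
  (forall e, e \in s -> E e) /\ forall nu, E nu -> exists e, e \in s /\ index_le e nu.
Proof.
suff main k : (k <= n)%N -> forall E' : multi_index n -> Prop,
    exists s : seq (multi_index n), (forall e, e \in s -> E' e) /\
    forall nu, E' nu -> exists e, e \in s /\ forall i : 'I_n, (i < k)%N -> (e i <= nu i)%N.
  have [s [sE h]] := main n (leqnn n) E; exists s; split=> // nu /h[e [es le]].
  by exists e; split=> //; apply/forallP => i; exact: le.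
elim: k => [_|k IHk kn] E'.
  have [[e Ee]|none] := pselect (exists e, E' e).
    by exists [:: e]; split=> [e'|nu _]; [rewrite inE => /eqP ->|exists e; rewrite inE].
  by exists [::]; split=> // nu Enu; case: none; exists nu.
have {}IHk := IHk (ltnW kn); pose k' := Ordinal kn.
have [s [sE hs]] := IHk E'.
pose N := (\max_(e <- s) e k')%N.
have [t tP] := choice (fun c => IHk (fun nu => E' nu /\ nu k' = c)).
exists (s ++ flatten [seq t c | c <- iota 0 N]); split=> [e|nu Enu].
  by rewrite mem_cat => /orP[/sE//|/flatten_mapP[c _ /(proj1 (tP c))[]]].
have [nuN|Nnu] := ltnP (nu k') N.
  have [e [et le]] := proj2 (tP (nu k')) nu (conj Enu erefl).
  exists e; split=> [|i].
    rewrite mem_cat; apply/orP; right; apply/flatten_mapP; exists (nu k') => //.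
    by rewrite mem_iota.
  rewrite ltnS leq_eqVlt => /orP[/eqP ik|/le//].
  have -> : i = k' by apply/val_inj.
  by have [_ ->] := proj1 (tP (nu k')) e et.
have [e [es le]] := hs nu Enu; exists e; split=> [|i]; first by rewrite mem_cat es.
rewrite ltnS leq_eqVlt => /orP[/eqP ik|/le//].
have -> : i = k' by apply/val_inj.
by apply: leq_trans Nnu; exact: leq_bigmax_seq.
Qed.

Definition weight (m : 'I_n -> nat) nu : nat := (\sum_i m i * nu i)%N.

Lemma weightD m mu nu : weight m (add_index mu nu) = (weight m mu + weight m nu)%N.
Proof. by rewrite /weight -big_split; apply: eq_bigr => i _; rewrite ffunE mulnDr. Qed.

(** Variable i is given the radius 2^-(K^(n-i)): earlier variables have far smaller radii, and even
    the last weight is K, not 1. *)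
Definition lex_weight K (i : 'I_n) : nat := (K ^ (n - i))%N.

(* Splitting at the first index i where e and nu differ, the loss
   sum_(j > i) e_j K^(n-j) <= |e| K^(n-i-1) is beaten by the gain K^(n-i). *)
Lemma lex_weight_gap e s B K nu : (degree e + s * (degree e).+1 + B < K)%N ->
  lex_lt e nu -> (weight (lex_weight K) e + s * degree nu + B <= weight (lex_weight K) nu)%N.
Proof.
move=> hK [i [eq lt]].
have K0 : (0 < K)%N by apply: leq_ltn_trans hK.
pose w := lex_weight K.
have ws j : (s <= w j)%N.
  rewrite /w /lex_weight -(subnSK (ltn_ord j)) expnS.
  apply: leq_trans (leq_pmulr _ _); last by rewrite expn_gt0 K0.
  nia.
have split3 (F : 'I_n -> nat) :
   (\sum_j F j = \sum_(j < n | (j < i)%N) F j + (F i + \sum_(j < n | (i < j)%N) F j))%N.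
  rewrite (bigID (fun j : 'I_n => (j < i)%N)); congr (_ + _)%N.
  rewrite (bigD1 i) ?ltnn//=; congr (_ + _)%N; apply: eq_bigl => j.
  by rewrite -leqNgt andbC [in RHS]ltn_neqAle eq_sym.
have tail : (\sum_(j < n | (i < j)%N) w j * e j <= K ^ (n - i.+1) * degree e)%N.
  apply: (@leq_trans (K ^ (n - i.+1) * \sum_(j < n | (i < j)%N) e j)); last first.
    by rewrite leq_mul2l /degree split3; lia.
  rewrite big_distrr /=; apply: leq_sum => j ij; rewrite leq_mul2r; apply/orP; right.
  by rewrite leq_pexp2l// leq_sub2l.
have tail' : (\sum_(j < n | (i < j)%N) s * nu j <= \sum_(j < n | (i < j)%N) w j * nu j)%N.
  by apply: leq_sum => j _; rewrite leq_mul2r ws orbT.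
have headw : (\sum_(j < n | (j < i)%N) w j * e j = \sum_(j < n | (j < i)%N) w j * nu j)%N.
  by apply: eq_bigr => j ji; rewrite eq.
have heads : (\sum_(j < n | (j < i)%N) s * nu j + s * e i <= s * degree e)%N.
  rewrite /degree split3 !mulnDr big_distrr /= leq_add//.
    by apply: leq_sum => j ji; rewrite eq.
  by rewrite leq_addr.
have wi : (K ^ (n - i.+1) * K = w i)%N.
  by rewrite /w /lex_weight -(subnSK (ltn_ord i)) expnSr.
have P0 : (0 < K ^ (n - i.+1))%N by rewrite expn_gt0 K0.
rewrite /weight -/w /degree big_distrr /= !split3 headw.
have := ws i; move: tail tail' heads wi P0.
set a := (K ^ _)%N; set d := degree e; move=> tail tail' heads wi a0 wsi.
have nuE : nu i = (e i + (nu i - (e i).+1).+1)%N by lia.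
move: (nu i - (e i).+1)%N nuE => c ->.
(* One extra unit in coordinate i pays for the tail of e, for B, and for s times that unit and the
   degree of e. The remaining c units pay for themselves since w i >= s. *)
have gain : (s * d + s + B + a * d <= w i)%N by rewrite -wi; nia.
have : (s * c <= w i * c)%N by rewrite leq_mul2r wsi orbT.
rewrite !mulnDr !mulnSr.
lia.
Qed.
End MultiIndices.

(** * Convergent power series *)

Import numFieldNormedType.Exports.
Local Open Scope classical_set_scope.

(** The intervals [x N - h N, x N + h N] meet pairwise, so the supremum of their left ends lies in
    all of them. *)
Lemma real_geometric_limit (R : realType) (x : nat -> R) (c : R) :
  (forall N N', (N <= N')%N -> `|x N' - x N| <= c * 2%:R^-1 ^+ N) ->
  exists l, forall N, `|l - x N| <= c * 2%:R^-1 ^+ N.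
Proof.
move=> hx; pose h N := c * 2%:R^-1 ^+ N.
have c0 : 0 <= c by have := hx 0%N 0%N (leqnn _); rewrite subrr normr0 expr0 mulr1.
have hmono N N' : (N <= N')%N -> h N' <= h N.
  move=> NN'; apply: ler_wpM2l => //; apply: ler_wiXn2l => //.
    by rewrite invr_ge0.
  by rewrite invf_le1 ?ltr0n// ler1n.
have h0 N : 0 <= h N by rewrite mulr_ge0// exprn_ge0// invr_ge0.
pose E := range (fun N => x N - h N).
have ub N : ubound E (x N + h N).
  move=> _ [M _ <-].
  have [NM|MN] := leqP N M.
    have := hx N M NM; rewrite ler_distl => /andP[_].
    by have := h0 M; rewrite -/(h N); lra.
  have := hx M N (ltnW MN); rewrite distrC ler_distl => /andP[_].
  by have := h0 N; rewrite -/(h M); lra.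
exists (sup E) => N; rewrite ler_distl; apply/andP; split.
  by apply: ub_le_sup; [exists (x 0%N + h 0%N); exact: ub|exists N].
by apply: ge_sup; [exists (x 0%N - h 0%N); exists 0%N|exact: ub].
Qed.

Section Convergence.
Variable R : realType.
Local Notation C := (Cplx R).
Local Notation half := (2%:R^-1 : C).

Lemma normc_real (k : R) : `|(k%:C)%C| = (`|k|%:C)%C :> R[i]%C.
Proof. by rewrite normc_def /= expr0n addr0 sqrtr_sqr. Qed.

Lemma normc_imaginary (k : R) : `|('i * k%:C)%C| = (`|k|%:C)%C :> R[i]%C.
Proof.
by rewrite normc_def /= !mul0r !mul1r subr0 add0r expr0n add0r sqrtr_sqr.
Qed.

Lemma normc_ge_Im (z : R[i]%C) : (`|complex.Im z|%:C)%C <= `|z|.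
Proof. by rewrite normc_def lecR -sqrtr_sqr ler_wsqrtr// lerDr sqr_ge0. Qed.

(** Real and imaginary parts converge separately, each within the given bound; adding them costs the
    factor 2. *)
Lemma geometric_limit (u : nat -> C) (c : C) :
  (forall N N', (N <= N')%N -> `|u N' - u N| <= c * half ^+ N) ->
  exists l, forall N, `|l - u N| <= 2 * c * half ^+ N.
Proof.
move=> hu.
have c0 : 0 <= c by have := hu 0%N 0%N (leqnn _); rewrite subrr normr0 expr0 mulr1.
have [k kE] : exists k : R, c = (k%:C)%C.
  by exists (complex.Re c); rewrite RRe_real// ger0_real.
have hE N : c * half ^+ N = ((k * 2%:R^-1 ^+ N)%:C)%C.
  by rewrite kE rmorphM rmorphXn /= fmorphV rmorph_nat.
have [|x xP] := @real_geometric_limit R (fun N => complex.Re (u N)) k.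
  move=> N N' NN'; rewrite -lecR -hE.
  by rewrite -raddfB (le_trans (normc_ge_Re _))// hu.
have [|y yP] := @real_geometric_limit R (fun N => complex.Im (u N)) k.
  move=> N N' NN'; rewrite -lecR -hE.
  by rewrite -raddfB (le_trans (normc_ge_Im _))// hu.
exists ((x%:C)%C + ('i * (y%:C))%C : C) => N.
rewrite [u N in leLHS]complexE opprD addrACA.
rewrite -[(_ * _)%C - _]mulrBr -!rmorphB.
apply: le_trans (ler_normD _ _) _; rewrite normc_imaginary normc_real.
by rewrite -mulrA mulr_natl mulr2n hE; apply: lerD; rewrite lecR.
Qed.
Lemma geometric_cvg (u : nat -> C) (l c : C) :
  (forall N, `|l - u N| <= c * half ^+ N) -> u N @[N --> \oo] --> l.
Proof.
move=> hu; have c0 : 0 <= c by have := hu 0%N; rewrite expr0 mulr1; exact: le_trans.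
apply/cvgrPdist_lt => e e0; have /cvgrPdist_lt/(_ _ e0) := cvg_half c0.
apply: filterS => N; rewrite sub0r normrN; apply: le_lt_trans.
rewrite [leRHS]ger0_norm; last by rewrite mulr_ge0// exprn_ge0// half_ge0.
by rewrite mulrC; exact: hu.
Qed.

End Convergence.

(** * Coefficient families and the functions they represent *)

Section Representation.
Variables (R : realType) (n : nat).
Local Notation C := (Cplx R).
Local Notation half := (2%:R^-1 : C).
Implicit Types (x z u : 'rV[C]_n) (f g : 'rV[C]_n -> C) (r M : C).
Implicit Types (a b : multi_index n -> C) (nu mu : multi_index n).

(** The condition of [holomorphic_at] with its coefficient family kept visible, since leading terms
    are read off the coefficients. *)
Definition represents x a f : Prop := exists r M,
  [/\ 0 < r, forall nu, `|a nu| * r ^+ degree nu <= M &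
    forall z, (forall i, `|z 0 i - x 0 i| < r) ->
      box_sum a (z - x) N @[N --> \oo] --> f z].

Lemma hol_fun_represented x (f : hol_fun x) : exists a, represents x a f.
Proof. by have [a [r [M h]]] := hol_funP f; exists a, r, M. Qed.

Lemma near_polydisc x r : 0 < r ->
  \forall z \near x, forall i, `|(z : 'rV[C]_n) 0 i - x 0 i| < r.
Proof.
move=> r0; apply/nbhs_ballP; exists r => // z [_ xz] i.
by have := xz 0 i; rewrite -ball_normE /= distrC.
Qed.

Lemma represents_unique x a f g :
  represents x a f -> represents x a g -> \forall z \near x, f z = g z.
Proof.
move=> [r1 [M1 [r10 _ fa]]] [r2 [M2 [r20 _ ga]]].
apply: filterS2 (near_polydisc x r10) (near_polydisc x r20) => z z1 z2.
exact: (cvg_unique _ (fa z z1) (ga z z2)).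
Qed.

Lemma representsD x a b f g : represents x a f -> represents x b g ->
  represents x (fun nu => a nu + b nu) (f + g).
Proof.
move=> [r1 [M1 [r10 ha fa]]] [r2 [M2 [r20 hb gb]]].
have [r [r0 rr1 rr2]] := common_radius r10 r20.
exists r, (M1 + M2); split=> // [nu|z zr].
  apply: (le_trans (ler_wpM2r _ (ler_normD _ _))); first by rewrite exprn_ge0 ?ltW.
  by rewrite mulrDl lerD ?(coef_bound_le r0 rr1 ha) ?(coef_bound_le r0 rr2 hb).
under eq_fun do rewrite /box_sum; under eq_fun do under eq_bigr do rewrite mulrDl.
under eq_fun do rewrite big_split.
apply: cvgD; [apply: fa|apply: gb] => i; exact: lt_le_trans (zr i) _.
Qed.

Lemma representsN x a f : represents x a f -> represents x (fun nu => - a nu) (- f).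
Proof.
move=> [r [M [r0 ha fa]]]; exists r, M.
split=> [|nu|z zr]; [exact: r0|by rewrite normrN; exact: ha|].
rewrite [X in X @ _ --> _](_ : _ = (fun N => - box_sum a (z - x) N)).
  exact: cvgN (fa z zr).
by apply/funext => N; rewrite /box_sum -sumrN; apply: eq_bigr => nu _; rewrite mulNr.
Qed.

Lemma coef_bound_ge0 a r M : 0 < r ->
  (forall nu, `|a nu| * r ^+ degree nu <= M) -> 0 <= M.
Proof.
move=> r0 ha; apply: le_trans (ha [ffun=> 0%N]).
by rewrite mulr_ge0// exprn_ge0// ltW.
Qed.

Lemma conv_bound a b r M1 M2 nu : 0 < r ->
  (forall nu, `|a nu| * r ^+ degree nu <= M1) ->
  (forall nu, `|b nu| * r ^+ degree nu <= M2) ->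
  `|conv a b nu| * (r / 4%:R) ^+ degree nu <= M1 * M2 * (2 ^+ n * 2 ^+ n).
Proof.
move=> r0 ha hb.
have M10 := coef_bound_ge0 r0 ha; have M20 := coef_bound_ge0 r0 hb.
have q0 k : 0 <= (r / 4%:R) ^+ k by rewrite exprn_ge0// divr_ge0// ltW.
apply: le_trans (conv_box n (degree nu).+1 M10 M20).
rewrite /conv; apply: le_trans (ler_wpM2r (q0 _) (ler_norm_sum _ _ _)) _.
rewrite mulr_suml; apply: ler_sum => mu _.
apply: le_trans (ler_wpM2r (q0 _) (ler_norm_sum _ _ _)) _.
rewrite mulr_suml; apply: ler_sum => la _.
have pos k l : 0 <= M1 * M2 * (half ^+ k * half ^+ l).
  by rewrite !mulr_ge0// exprn_ge0// half_ge0.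
case: eqP => [e|_]; last by rewrite normr0 mul0r.
have := conv_term (of_box mu) (of_box la) r0 ha hb; rewrite e => /le_trans; apply.
by rewrite ler_piMl// exprn_ile1 ?half_ge0 ?half_le1.
Qed.

Lemma representsM x a b f g : represents x a f -> represents x b g ->
  represents x (conv a b) (f * g).
Proof.
move=> [r1 [M1 [r10 ha fa]]] [r2 [M2 [r20 hb gb]]].
have [r [r0 rr1 rr2]] := common_radius r10 r20.
have {}ha := coef_bound_le r0 rr1 ha; have {}hb := coef_bound_le r0 rr2 hb.
have M10 := coef_bound_ge0 r0 ha; have M20 := coef_bound_ge0 r0 hb.
have r4r : r / 4%:R <= r.
  by rewrite ler_pdivrMr// mulr_natr mulrS lerDl mulrn_wge0// ltW.
exists (r / 4%:R), (M1 * M2 * (2 ^+ n * 2 ^+ n)); split=> [|nu|z zr].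
- by rewrite divr_gt0.
- exact: conv_bound.
have zlt r' : r <= r' -> forall i, `|z 0 i - x 0 i| < r'.
  by move=> rr' i; apply: lt_le_trans (zr i) (le_trans r4r rr').
pose d N := box_sum a (z - x) N * box_sum b (z - x) N - box_sum (conv a b) (z - x) N.
have K0 : 0 <= M1 * M2 * (2 ^+ n * 2 ^+ n) by rewrite !mulr_ge0// exprn_ge0.
have d0 : d N @[N --> \oo] --> (0 : C).
  apply/cvgrPdist_lt => e e0.
  have /cvgrPdist_lt/(_ _ e0) := cvg_half K0; apply: filterS => N.
  rewrite !sub0r !normrN; apply: le_lt_trans; rewrite [leRHS]ger0_norm; last first.
    by rewrite mulr_ge0// exprn_ge0// half_ge0.
  by apply: conv_defect r0 ha hb _ => i; rewrite !mxE; exact: zr.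
rewrite [X in X @ _ --> _](_ : _ =
  (fun N => box_sum a (z - x) N * box_sum b (z - x) N - d N)); last first.
  by apply/funext => N; rewrite /d subKr.
rewrite -[X in _ --> X]/(f z * g z) -[f z * g z]subr0.
exact: cvgB (cvgM (fa z (zlt _ rr1)) (gb z (zlt _ rr2))) d0.
Qed.

(** At a quarter of the radius a term gains 4^-|nu|, split into two powers of 1/2: one is summed
    over all indices, the other gives the rate of convergence. *)
Lemma term_bound a r M u nu : 0 < r ->
  (forall nu, `|a nu| * r ^+ degree nu <= M) -> (forall i, `|u 0 i| <= r / 4%:R) ->
  `|a nu * monomial u nu| <= M * (half ^+ degree nu * half ^+ degree nu).
Proof.
move=> r0 ha ur; rewrite normrM.
apply: le_trans (_ : `|a nu| * (r / 4%:R) ^+ degree nu <= _).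
  apply: ler_wpM2l => //; rewrite /monomial normr_prod /degree -prodrXr.
  apply: ler_prod => j _; rewrite normr_ge0/= normrX.
  by apply: lerXn2r; rewrite ?nnegrE ?ur// divr_ge0// ltW.
rewrite -exprMn -invfM -natrM exprMn mulrA; apply: ler_wpM2r => //.
by rewrite exprn_ge0// invr_ge0.
Qed.

Lemma box_sum_cauchy a r M u N N' : 0 < r ->
  (forall nu, `|a nu| * r ^+ degree nu <= M) -> (forall i, `|u 0 i| <= r / 4%:R) ->
  (N <= N')%N -> `|box_sum a u N' - box_sum a u N| <= M * 2 ^+ n * half ^+ N.
Proof.
move=> r0 ha ur NN'; have M0 := coef_bound_ge0 r0 ha.
(* [F] extends the smaller box by zero, so that the difference contains only terms with some
   exponent, hence the degree, at least N. *)
pose F nu := if [forall i, nu i < N]%N then a nu * monomial u nu else 0.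
have -> : box_sum a u N = \sum_(nu : {ffun 'I_n -> 'I_N'}) F (of_box nu).
  rewrite (box_indep NN'); last first.
    move=> nu i Ni; rewrite /F ifF//; apply/negbTE/forallPn; exists i.
    by rewrite -leqNgt.
  apply: eq_bigr => nu _; rewrite /F ifT//; apply/forallP => i.
  by rewrite ffunE.
rewrite -sumrB; apply: le_trans (ler_norm_sum _ _ _) _.
rewrite -mulrA [_ * half ^+ N]mulrC mulrA.
apply: le_trans (ler_wpM2l _ (geometric_box R n N')); last first.
  by rewrite mulr_ge0// exprn_ge0// half_ge0.
rewrite mulr_sumr; apply: ler_sum => nu _; rewrite /F.
case: forallP => [_|out].
  by rewrite subrr normr0 !mulr_ge0// exprn_ge0// half_ge0.
have [i Ni] : exists i, (N <= of_box nu i)%N.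
  apply: contrapT => none; apply: out => i; rewrite ltnNge; apply/negP => Ni.
  by apply: none; exists i.
rewrite subr0; apply: le_trans (term_bound _ r0 ha ur) _.
rewrite mulrA; apply: ler_wpM2r; first by rewrite exprn_ge0// half_ge0.
apply: ler_wpM2l => //; apply: ler_wiXn2l; rewrite ?half_ge0 ?half_le1//.
exact: leq_trans Ni (le_degree _ i).
Qed.

Lemma represents_exists x a r M : 0 < r ->
  (forall nu, `|a nu| * r ^+ degree nu <= M) -> exists f : hol_fun x, represents x a f.
Proof.
move=> r0 ha; have M0 := coef_bound_ge0 r0 ha.
have r40 : 0 < r / 4%:R by rewrite divr_gt0.
have /choice[f fP] : forall z : 'rV[C]_n, exists l : C,
    (forall i, `|z 0 i - x 0 i| < r / 4%:R) ->
    box_sum a (z - x) N @[N --> \oo] --> l.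
  (* Outside the polydisc the value is arbitrary and set to 0. *)
  move=> z; have [zr|nzr] := pselect (forall i, `|z 0 i - x 0 i| < r / 4%:R); last by exists 0.
  have [|l lP] := @geometric_limit R (box_sum a (z - x)) (M * 2 ^+ n).
    by move=> N N' NN'; apply: (box_sum_cauchy r0) => // i; rewrite !mxE ltW.
  by exists l => _; exact: geometric_cvg lP.
have rep : represents x a f.
  exists (r / 4%:R), M; split=> //; apply: (coef_bound_le r40 _ ha).
  by rewrite ler_pdivrMr// mulr_natr mulrS lerDl mulrn_wge0// ltW.
have holf : f \in @holomorphic_pred R n x.
  by apply/holomorphic_predP; have [r' [M' ?]] := rep; exists a, r', M'.
by exists (HolFun holf).
Qed.

End Representation.

(** * The weighted l^1 norm *)

Section WeightedNorm.
Variables (R : realType) (n : nat).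
Local Notation C := (Cplx R).
Local Notation half := (2%:R^-1 : C).
Implicit Types (r M : C) (a b : multi_index n -> C) (nu mu la e : multi_index n).
Implicit Types (m : 'I_n -> nat).

Lemma exists_half_le (K d : C) : 0 <= K -> 0 < d -> exists B, K * half ^+ B <= d.
Proof.
move=> K0 d0; have /cvgrPdist_lt/(_ d d0)[N _ /(_ N (leqnn N))] := cvg_half K0.
rewrite /= sub0r normrN ger0_norm ?mulr_ge0 ?exprn_ge0 ?half_ge0// => h.
by exists N; rewrite mulrC ltW.
Qed.

Definition wterm m a nu : C := `|a nu| * half ^+ weight m nu.

Lemma wterm_ge0 m a nu : 0 <= wterm m a nu.
Proof. by rewrite mulr_ge0// exprn_ge0// half_ge0. Qed.

(* Finite sums stand in for the weighted l^1 norm, so that no supremum is needed. *)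
Definition wbounded m a M : Prop :=
  forall l : seq (multi_index n), uniq l -> \sum_(nu <- l) wterm m a nu <= M.

Lemma wbounded_ge0 m a M : wbounded m a M -> 0 <= M.
Proof. by move=> /(_ [::] isT); rewrite big_nil. Qed.

Lemma wbounded_term m a M nu : wbounded m a M -> wterm m a nu <= M.
Proof. by move=> /(_ [:: nu] isT); rewrite big_seq1. Qed.

Lemma wbounded_le m a M M' : wbounded m a M -> M <= M' -> wbounded m a M'.
Proof. by move=> h MM' l /h /le_trans; apply. Qed.

Lemma wboundedN m a M : wbounded m a M -> wbounded m (fun nu => - a nu) M.
Proof.
move=> h l /h; rewrite (eq_bigr (wterm m (fun nu => - a nu)))// => nu _.
by rewrite /wterm normrN.
Qed.

Lemma wbounded_sum m (J : finType) (a : J -> multi_index n -> C) (M : J -> C) :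
  (forall j, wbounded m (a j) (M j)) ->
  wbounded m (fun nu => \sum_j a j nu) (\sum_j M j).
Proof.
move=> h l ul; apply: (@le_trans _ _ (\sum_j \sum_(nu <- l) wterm m (a j) nu)).
  rewrite exchange_big; apply: ler_sum => nu _; rewrite /wterm -mulr_suml.
  by rewrite ler_wpM2r ?ler_norm_sum// exprn_ge0// half_ge0.
by apply: ler_sum => j _; exact: h.
Qed.

Lemma sum_pick_le (l : seq (multi_index n)) mu (t : C) : uniq l -> 0 <= t ->
  \sum_(nu <- l) (if mu == nu then t else 0) <= t.
Proof.
move=> ul t0; rewrite -big_mkcond; have [mul|mul] := boolP (mu \in l).
  rewrite -big_filter (_ : [seq i <- l | mu == i] = [:: mu]) ?big_seq1//.
  by rewrite (eq_filter (a2 := pred1 mu)) ?filter_pred1_uniq// => i /=; rewrite eq_sym.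
by rewrite big_seq_cond big1// => nu /andP[nul /eqP E]; rewrite E nul in mul.
Qed.

Lemma sum_box (g : multi_index n -> C) N :
  \sum_(nu : {ffun 'I_n -> 'I_N}) g (of_box nu) =
  \sum_(nu <- [seq of_box nu | nu : {ffun 'I_n -> 'I_N}]) g nu.
Proof. by rewrite big_map big_enum. Qed.

Lemma uniq_box N : uniq [seq of_box nu | nu : {ffun 'I_n -> 'I_N}].
Proof. by rewrite map_inj_uniq ?enum_uniq//; exact: of_box_inj. Qed.

Lemma box_contains (l : seq (multi_index n)) :
  exists N, forall nu, nu \in l -> forall i, (nu i < N)%N.
Proof.
exists (\max_(nu <- l) degree nu).+1 => nu nul i; rewrite ltnS.
by apply: leq_trans (le_degree nu i) _; exact: leq_bigmax_seq.
Qed.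

(** Submultiplicativity of the norm: each pair (mu, la) contributes to the single index mu + la, and
    the weight is additive. *)
Lemma wbounded_conv m a b Ma Mb : wbounded m a Ma -> wbounded m b Mb ->
  wbounded m (conv a b) (Ma * Mb).
Proof.
move=> ha hb l ul; have [N lN] := box_contains l.
pose box := [seq of_box nu | nu : {ffun 'I_n -> 'I_N}].
apply: (@le_trans _ _ ((\sum_(mu <- box) wterm m a mu) * (\sum_(la <- box) wterm m b la))).
  rewrite mulr_suml; under [leRHS]eq_bigr do rewrite mulr_sumr.
  apply: (@le_trans _ _ (\sum_(mu <- box) \sum_(la <- box) \sum_(nu <- l)
      (if add_index mu la == nu then wterm m a mu * wterm m b la else 0))); last first.
    apply: ler_sum => mu _; apply: ler_sum => la _; apply: sum_pick_le => //.
    by rewrite mulr_ge0// wterm_ge0.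
  under [leRHS]eq_bigr do rewrite exchange_big; rewrite exchange_big /=.
  rewrite big_seq [leRHS]big_seq; apply: ler_sum => nu nul.
  rewrite /wterm (convE _ _ (lN nu nul)) /box -sum_box.
  apply: le_trans (ler_wpM2r _ (ler_norm_sum _ _ _)) _.
    by rewrite exprn_ge0// half_ge0.
  rewrite mulr_suml; apply: ler_sum => mu _; rewrite -sum_box.
  apply: le_trans (ler_wpM2r _ (ler_norm_sum _ _ _)) _.
    by rewrite exprn_ge0// half_ge0.
  rewrite mulr_suml; apply: ler_sum => la _.
  case: eqP => [<-|_]; last by rewrite normr0 mul0r.
  by rewrite normrM weightD exprD mulrACA.
apply: ler_pM; rewrite ?ha ?hb ?uniq_box//;
  by apply: sumr_ge0 => nu _; exact: wterm_ge0.
Qed.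

Lemma sum_half_degree (l : seq (multi_index n)) : uniq l ->
  \sum_(nu <- l) half ^+ degree nu <= 2 ^+ n.
Proof.
move=> ul; have [N lN] := box_contains l.
apply: le_trans (geometric_box R n N).
rewrite (@sum_box (fun nu => half ^+ degree nu)).
set box := [seq of_box nu | nu : {ffun 'I_n -> 'I_N}].
have box_has nu : nu \in l -> nu \in box.
  by move=> /lN /of_boxP[nu' <-]; apply: map_f; rewrite mem_enum.
apply: (@le_trans _ _ (\sum_(nu <- l) \sum_(mu <- box)
    (if mu == nu then half ^+ degree mu else 0))).
  rewrite big_seq [leRHS]big_seq; apply: ler_sum => nu nul.
  rewrite (big_rem nu) ?box_has//= eqxx lerDl sumr_ge0// => mu _.
  by case: ifP => // _; rewrite exprn_ge0// half_ge0.
rewrite exchange_big; apply: ler_sum => mu _; apply: sum_pick_le => //.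
by rewrite exprn_ge0// half_ge0.
Qed.

Lemma geometric_wbounded m a M : 0 <= M ->
  (forall nu, wterm m a nu <= M * half ^+ degree nu) -> wbounded m a (M * 2 ^+ n).
Proof.
move=> M0 h l ul; apply: le_trans (ler_sum _ (fun nu _ => h nu)) _.
by rewrite -mulr_sumr ler_wpM2l// sum_half_degree.
Qed.

(** Shrinking the radius to a power of 1/2 turns the later estimates into comparisons of natural
    exponents. *)
Lemma coef_bound_half a r M : 0 < r ->
  (forall nu, `|a nu| * r ^+ degree nu <= M) ->
  exists s, forall nu, `|a nu| * half ^+ (s * degree nu) <= M.
Proof.
move=> r0 ha; have [s] := exists_half_le ler01 r0; rewrite mul1r => sr.
exists s => nu; apply: le_trans (ha nu); apply: ler_wpM2l => //; rewrite exprM.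
by apply: lerXn2r; rewrite ?nnegrE ?exprn_ge0 ?half_ge0// ltW.
Qed.

Lemma half_mono i j : (i <= j)%N -> half ^+ j <= half ^+ i.
Proof. by move=> ij; apply: ler_wiXn2l; rewrite ?half_ge0 ?half_le1. Qed.

Lemma wbounded_lex_weight a r M : 0 < r ->
  (forall nu, `|a nu| * r ^+ degree nu <= M) ->
  exists K0, forall K, (K0 <= K)%N -> wbounded (lex_weight K) a (M * 2 ^+ n).
Proof.
move=> r0 ha; have M0 := coef_bound_ge0 r0 ha.
have [s hs] := coef_bound_half r0 ha; exists s.+1 => K sK.
apply: geometric_wbounded => // nu.
(* Every weight is at least K > s: s per degree offsets the growth of the coefficients, and one more
   makes the family summable. *)
have w : (s * degree nu + degree nu <= weight (lex_weight K) nu)%N.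
  rewrite -mulSnr /weight /degree big_distrr; apply: leq_sum => i _ /=.
  rewrite leq_mul2r; apply/orP; right; apply: (leq_trans sK).
  rewrite /lex_weight -(subnSK (ltn_ord i)) expnS leq_pmulr// expn_gt0.
  by rewrite (leq_ltn_trans (leq0n s) sK).
apply: le_trans (_ : `|a nu| * half ^+ (s * degree nu + degree nu) <= _).
  by rewrite ler_wpM2l// half_mono.
by rewrite exprD mulrA ler_wpM2r ?hs// exprn_ge0// half_ge0.
Qed.

Definition tail a e nu : C := if nu == e then 0 else a nu.

Lemma tail_small a r M e (d : C) : 0 < r ->
  (forall nu, `|a nu| * r ^+ degree nu <= M) ->
  (forall nu, a nu != 0 -> nu = e \/ lex_lt e nu) -> 0 < d ->
  exists K0, forall K, (K0 <= K)%N ->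
    wbounded (lex_weight K) (tail a e) (d * half ^+ weight (lex_weight K) e).
Proof.
move=> r0 ha min d0; have M0 := coef_bound_ge0 r0 ha.
have [s hs] := coef_bound_half r0 ha.
have [B hB] : exists B, M * 2 ^+ n * half ^+ B <= d.
  by apply: exists_half_le => //; rewrite mulr_ge0// exprn_ge0.
exists (degree e + s.+1 * (degree e).+1 + B).+1 => K hK.
set w := lex_weight K; have hw k : 0 <= half ^+ k by rewrite exprn_ge0// half_ge0.
apply: (@wbounded_le _ _ (M * half ^+ B * half ^+ weight w e * 2 ^+ n)); last first.
  by rewrite mulrAC ler_wpM2r//; apply: le_trans hB; rewrite mulrAC.
apply: geometric_wbounded => [|nu]; first by rewrite !mulr_ge0.
rewrite /wterm /tail; case: eqP => [_|ne]; first by rewrite normr0 mul0r !mulr_ge0.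
have [->|nz] := eqVneq (a nu) 0; first by rewrite normr0 mul0r !mulr_ge0.
have [//|lt] := min nu nz.
have gap : (s * degree nu + (B + weight w e + degree nu) <= weight w nu)%N.
  by apply: leq_trans (lex_weight_gap hK lt); rewrite -/w mulSn; lia.
apply: le_trans (_ : `|a nu| * half ^+ (s * degree nu + (B + weight w e + degree nu)) <= _).
  by rewrite ler_wpM2l// half_mono.
rewrite exprD mulrA; apply: le_trans (ler_wpM2r (hw _) (hs nu)) _.
by rewrite !exprD !mulrA.
Qed.

End WeightedNorm.

(** * Division by finitely many power series *)

Section Division.
Variables (R : realType) (n : nat).
Local Notation C := (Cplx R).
Local Notation half := (2%:R^-1 : C).
Implicit Types (r M : C) (a b c : multi_index n -> C) (nu mu la : multi_index n).

Lemma convDl a b c nu :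
  conv (fun nu => a nu + b nu) c nu = conv a c nu + conv b c nu.
Proof.
rewrite /conv -big_split; apply: eq_bigr => mu _ /=.
rewrite -big_split; apply: eq_bigr => la _ /=.
by case: ifP => _; rewrite ?mulrDl ?addr0.
Qed.

Lemma convDr a b c nu :
  conv a (fun nu => b nu + c nu) nu = conv a b nu + conv a c nu.
Proof.
rewrite /conv -big_split; apply: eq_bigr => mu _ /=.
rewrite -big_split; apply: eq_bigr => la _ /=.
by case: ifP => _; rewrite ?mulrDr ?addr0.
Qed.

Lemma conv0l a nu : conv (fun=> 0) a nu = 0.
Proof.
by apply: big1 => mu _; apply: big1 => la _; case: ifP => _; rewrite ?mul0r.
Qed.

Lemma conv_delta a e (k : C) nu : conv a (fun la => if la == e then k else 0) nu =
  if index_le e nu then a (shift_index nu e) * k else 0.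
Proof.
rewrite /conv; set N := (degree nu).+1.
have nuN i : (nu i < N)%N by rewrite ltnS le_degree.
have [le|nle] := boolP (index_le e nu); last first.
  apply: big1 => mu _; apply: big1 => la _; case: eqP => // E.
  case: eqP => [le'|]; last by rewrite mulr0.
  by rewrite -E le' le_add_index in nle.
have [mu0 mu0E] : exists mu0 : {ffun 'I_n -> 'I_N}, of_box mu0 = shift_index nu e.
  by apply: of_boxP => i; rewrite ffunE (leq_ltn_trans (leq_subr _ _)).
have [la0 la0E] : exists la0 : {ffun 'I_n -> 'I_N}, of_box la0 = e.
  by apply: of_boxP => i; apply: leq_ltn_trans (nuN i); move/forallP: le; apply.
rewrite (bigD1 mu0)//= [X in _ + X]big1 ?addr0 => [|mu mumu0]; last first.
  apply: big1 => la _; case: eqP => // E; case: eqP => [le'|]; last by rewrite mulr0.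
  case/eqP: mumu0; apply: (@of_box_inj _ N).
  by rewrite mu0E -E le' shift_add.
rewrite (bigD1 la0)//= [X in _ + X]big1 ?addr0 => [|la lala0]; last first.
  rewrite -la0E (inj_eq (@of_box_inj _ N)) (negbTE lala0) mulr0.
  by case: ifP.
by rewrite mu0E la0E add_shift// !eqxx.
Qed.

Lemma cvg_sums (I : Type) (l : seq I) (u : I -> nat -> C) (v : I -> C) :
  (forall i, u i N @[N --> \oo] --> v i) ->
  \sum_(i <- l) u i N @[N --> \oo] --> \sum_(i <- l) v i.
Proof.
move=> h; elim: l => [|i l IH].
  by under eq_fun do rewrite big_nil; rewrite big_nil; exact: cvg_cst.
under eq_fun do rewrite big_cons; rewrite big_cons.
exact: (cvgD (h i) IH).
Qed.

Variables (J : finType) (e : J -> multi_index n) (F : J -> multi_index n -> C).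
Hypothesis F_bound : forall j, exists r M,
  0 < r /\ forall nu, `|F j nu| * r ^+ degree nu <= M.
Hypothesis F_lead : forall j, F j (e j) != 0.
Hypothesis F_min : forall j nu, F j nu != 0 -> nu = e j \/ lex_lt (e j) nu.

(** The choice depends on nu alone, so the indices are partitioned between the divisors and the
    remainder, and the naive splitting is linear in the dividend. *)
Definition divider nu : option J := [pick j | index_le (e j) nu].

Definition quot j a mu : C :=
  if divider (add_index mu (e j)) == Some j
  then a (add_index mu (e j)) / F j (e j) else 0.

Definition rest a nu : C := if divider nu is Some _ then 0 else a nu.

(** What one naive division, with quotients [quot j a] and remainder [rest a], leaves of a; it is
    the next dividend. *)
Definition div_step a nu : C := - \sum_j conv (quot j a) (tail (F j) (e j)) nu.

Definition recompose a nu : C := \sum_j conv (quot j a) (F j) nu + rest a nu.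

(** Each [F j] is its leading monomial plus its tail. The leading monomials times the quotients,
    together with [rest a], give back a exactly; only the tails remain. *)
Lemma recomposeE a nu : recompose a nu = a nu - div_step a nu.
Proof.
rewrite /recompose /div_step opprK.
rewrite (eq_bigr (fun j => conv (quot j a) (tail (F j) (e j)) nu +
  (if divider nu == Some j then a nu else 0))); last first.
  move=> j _; rewrite [in LHS](_ : F j = (fun la => tail (F j) (e j) la +
      (if la == e j then F j (e j) else 0))); last first.
    by apply/funext => la; rewrite /tail; case: eqP => [->|_]; rewrite ?add0r ?addr0.
  rewrite convDr conv_delta; congr (_ + _); case: ifPn => [le|nle].
    by rewrite /quot add_shift//; case: ifP => _; rewrite ?mul0r// divfK.
  rewrite ifN//; apply: contraNN nle => /eqP; rewrite /divider.
  by case: pickP => // j' le [<-].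
rewrite big_split /= -addrA [RHS]addrC; congr (_ + _).
rewrite /rest; case: divider => [j|].
  by rewrite addr0 (bigD1 j)//= eqxx big1 ?addr0// => i ij; rewrite ifN// eq_sym.
by rewrite big1 ?add0r.
Qed.

Lemma quotD j a b : quot j (fun nu => a nu + b nu) = (fun nu => quot j a nu + quot j b nu).
Proof. by apply/funext => mu; rewrite /quot; case: ifP; rewrite ?addr0 ?mulrDl. Qed.

Lemma recomposeD a b nu :
  recompose (fun nu => a nu + b nu) nu = recompose a nu + recompose b nu.
Proof.
rewrite /recompose addrACA -big_split; congr (_ + _).
  by apply: eq_bigr => j _; rewrite quotD convDl.
by rewrite /rest; case: divider => // _; rewrite addr0.
Qed.

Lemma recompose0 nu : recompose (fun=> 0) nu = 0.
Proof.
rewrite /recompose big1 ?add0r => [|j _].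
  by rewrite /rest; case: divider.
rewrite (_ : quot j _ = fun=> 0) ?conv0l//.
by apply/funext => mu; rewrite /quot mul0r if_same.
Qed.

(** A coefficient of [recompose] involves only finitely many coefficients of its argument, so
    coefficientwise convergence is enough. *)
Lemma recompose_cvg (u : nat -> multi_index n -> C) (a : multi_index n -> C) nu :
  (forall mu, u N mu @[N --> \oo] --> a mu) ->
  recompose (u N) nu @[N --> \oo] --> recompose a nu.
Proof.
move=> ua; rewrite /recompose; apply: cvgD; last first.
  by rewrite /rest; case: divider => [_|]; [exact: cvg_cst|exact: ua].
apply: cvg_sums => j; rewrite /conv; apply: cvg_sums => mu; apply: cvg_sums => la.
case: ifP => _; last exact: cvg_cst.
apply: cvgM; last exact: cvg_cst.
rewrite /quot; case: ifP => _; last exact: cvg_cst.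
by apply: cvgM; [exact: ua|exact: cvg_cst].
Qed.

Lemma wbounded_quot m j a M : wbounded m a M ->
  wbounded m (quot j a) (M / (`|F j (e j)| * half ^+ weight m (e j))).
Proof.
move=> ha l ul; have he : 0 < half ^+ weight m (e j) by rewrite exprn_gt0// invr_gt0.
have d0 : 0 < `|F j (e j)| * half ^+ weight m (e j) by rewrite mulr_gt0// normr_gt0.
rewrite ler_pdivlMr// mulr_suml.
have ul' : uniq [seq add_index mu (e j) | mu <- l].
  rewrite map_inj_uniq// => mu mu' /(congr1 ((@shift_index n)^~ (e j))).
  by rewrite !shift_add.
apply: le_trans (ha _ ul'); rewrite big_map; apply: ler_sum => mu _.
rewrite /wterm /quot weightD exprD; case: ifP => _.
  rewrite normrM normfV mulrACA divfK ?normr_eq0//.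
by rewrite normr0 !mul0r !mulr_ge0// exprn_ge0// half_ge0.
Qed.

(** The weighted size of the leading term cancels between the quotient and the tail, so each j
    contributes M half / (#|J| + 1), and the sum is at most M half. The added 1 keeps the
    denominator nonzero for empty J. *)
Lemma wbounded_div_step m a M :
  (forall j, wbounded m (tail (F j) (e j))
     (`|F j (e j)| * (half / #|J|.+1%:R) * half ^+ weight m (e j))) ->
  wbounded m a M -> wbounded m (div_step a) (M * half).
Proof.
move=> ht ha; apply: wboundedN; have M0 := wbounded_ge0 ha.
have := wbounded_sum (fun j => wbounded_conv (wbounded_quot j ha) (ht j)).
move=> /wbounded_le; apply.
rewrite (eq_bigr (fun=> M * half / #|J|.+1%:R)) => [|j _]; last first.
  have he : half ^+ weight m (e j) != 0 by rewrite expf_neq0// invr_eq0 pnatr_eq0.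
  have := F_lead j; rewrite -normr_eq0; set x := `|_|; move: he; set h := half ^+ _ => he x0.
  have k0 : #|J|.+1%:R != 0 :> C by rewrite pnatr_eq0.
  by move: {+}(_.+1%:R) k0 (half) => k k0 hf; field; rewrite x0 he k0.
rewrite sumr_const -[leLHS]mulr_natr -[leLHS]mulrA; apply: ler_piMr.
  by rewrite mulr_ge0// half_ge0.
by rewrite mulrC ler_pdivrMr// mul1r ler_nat.
Qed.

(* Iterating div_step gives a geometric series A with A - div_step A = a, so the
   quotients and the remainder of a are those of A under the naive splitting. *)
Lemma division a r M : 0 < r -> (forall nu, `|a nu| * r ^+ degree nu <= M) ->
  exists (Q : J -> multi_index n -> C) (rem : multi_index n -> C),
    [/\ exists r' M', 0 < r' /\ forall nu, `|rem nu| * r' ^+ degree nu <= M',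
        forall j, exists r' M', 0 < r' /\ forall nu, `|Q j nu| * r' ^+ degree nu <= M',
        forall nu j, index_le (e j) nu -> rem nu = 0
      & forall nu, a nu = \sum_j conv (Q j) (F j) nu + rem nu].
Proof.
move=> r0 ha; have [Ka hKa] := wbounded_lex_weight r0 ha.
have /choice[Kt hKt] : forall j, exists K0, forall K, (K0 <= K)%N ->
    wbounded (lex_weight K) (tail (F j) (e j))
     (`|F j (e j)| * (half / #|J|.+1%:R) * half ^+ weight (lex_weight K) (e j)).
  move=> j; have [r' [M' [r'0 hF]]] := F_bound j.
  apply: (tail_small r'0 hF (@F_min j)).
  by rewrite !mulr_gt0// ?normr_gt0 ?invr_gt0.
(* One K serves the dividend and all divisors, because J is finite. *)
pose K := maxn Ka (\max_j Kt j); pose m := @lex_weight n K.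
have {hKa} am : wbounded m a (M * 2 ^+ n) by apply: hKa; exact: leq_maxl.
have {hKt} tm j : wbounded m (tail (F j) (e j))
     (`|F j (e j)| * (half / #|J|.+1%:R) * half ^+ weight m (e j)).
  by apply: hKt; rewrite leq_max (leq_bigmax j) orbT.
set M1 := M * 2 ^+ n in am; have M10 := wbounded_ge0 am.
pose t k := iter k div_step a.
have tb k : wbounded m (t k) (M1 * half ^+ k).
  elim: k => [|k IH]; first by rewrite mulr1.
  by rewrite exprSr mulrA; exact: wbounded_div_step.
pose S N nu := \sum_(k < N) t k nu.
have hw nu : 0 < half ^+ weight m nu by rewrite exprn_gt0// invr_gt0.
have tle k nu : `|t k nu| <= M1 / half ^+ weight m nu * half ^+ k.
  by rewrite mulrAC ler_pdivlMr//; exact: wbounded_term (tb k).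
have SS N nu : S N.+1 nu = S N nu + t N nu by rewrite /S big_ord_recr.
have Sc nu N N' : (N <= N')%N ->
    `|S N' nu - S N nu| <= 2 * (M1 / half ^+ weight m nu) * half ^+ N.
  have c0 : 0 <= M1 / half ^+ weight m nu by rewrite divr_ge0// ltW.
  move: (M1 / _) c0 (tle^~ nu) => c c0 tlec NN'.
  (* The bound is sharpened to a difference, which grows at each step of the induction by exactly
     the size allowed for the new term. *)
  apply: (@le_trans _ _ (2 * c * half ^+ N - 2 * c * half ^+ N')); last first.
    by rewrite gerBl !mulr_ge0// exprn_ge0// half_ge0.
  rewrite -(subnKC NN'); elim: (N' - N)%N => [|k IH].
    by rewrite addn0 !subrr normr0.
  rewrite addnS SS addrAC; apply: le_trans (ler_normD _ _) _.
  apply: le_trans (lerD IH (tlec _)) _.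
  rewrite exprS; set h := half ^+ (N + k); set h' := half ^+ N.
  by rewrite le_eqVlt; apply/orP; left; apply/eqP; field.
have /choice[A hA] : forall nu, exists l : C, forall N,
    `|l - S N nu| <= 2 * (2 * (M1 / half ^+ weight m nu)) * half ^+ N.
  by move=> nu; apply: geometric_limit; exact: Sc.
have SA nu : S N nu @[N --> \oo] --> A nu by exact: geometric_cvg (hA nu).
have SE N nu : recompose (S N) nu = a nu - t N nu.
  elim: N => [|N IH].
    rewrite (_ : S 0%N = fun=> 0) ?recompose0 ?subrr//.
    by apply/funext => mu; rewrite /S big_ord0.
  rewrite (_ : S N.+1 = fun nu => S N nu + t N nu); last by apply/funext => mu.
  by rewrite recomposeD IH recomposeE addrA subrK.
have AE nu : a nu = recompose A nu.
  have := recompose_cvg (nu := nu) SA; under eq_fun do rewrite SE.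
  have : (fun N => a nu - t N nu) N @[N --> \oo] --> a nu.
    apply: (@geometric_cvg _ _ _ (M1 / half ^+ weight m nu)) => N.
    by rewrite opprB addrC subrK.
  exact: cvg_unique.
have [q [M2 [q0 hq]]] : exists q M2, 0 < q /\ forall nu, `|A nu| * q ^+ degree nu <= M2.
  (* The weight of nu is at most (sum of the m i) times its degree, so this common radius fits
     inside the weighted polydisc. *)
  exists (half ^+ (\sum_i m i)), (2 * (2 * M1)); split=> [|nu].
    by rewrite exprn_gt0// invr_gt0.
  have := hA nu 0%N; rewrite /S big_ord0 subr0 expr0 mulr1 !mulrA ler_pdivlMr//.
  apply: le_trans; rewrite -exprM ler_wpM2l// half_mono// /weight big_distrl /=.
  by apply: leq_sum => i _; rewrite leq_mul2l le_degree orbT.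
have M20 := coef_bound_ge0 q0 hq.
exists (quot^~ A), (rest A); split.
- exists q, M2; split=> // nu; rewrite /rest; case: divider => [_|//].
  by rewrite normr0 mul0r.
- move=> j; exists q, (M2 / (`|F j (e j)| * q ^+ degree (e j))); split=> // nu.
  have d0 : 0 < `|F j (e j)| * q ^+ degree (e j).
    by rewrite mulr_gt0 ?normr_gt0// exprn_gt0.
  rewrite ler_pdivlMr// /quot; case: ifP => _; last by rewrite normr0 !mul0r.
  rewrite normrM normfV mulrACA divfK ?normr_eq0// -exprD -degreeD.
  exact: hq.
- move=> nu j le; rewrite /rest /divider; case: pickP => // /(_ j).
  by rewrite le.
- exact: AE.
Qed.
End Division.

(** * Germs *)

Section GermRing.
Variables (R : realType) (n : nat).
Local Notation C := (Cplx R).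
Local Notation half := (2%:R^-1 : C).

Lemma represents_sum (x : 'rV[C]_n) (J : Type) (l : seq J) (h : J -> hol_fun x)
    (a : J -> multi_index n -> C) : (forall j, represents x (a j) (h j)) ->
  represents x (fun nu => \sum_(j <- l) a j nu) (\sum_(j <- l) h j : hol_fun x).
Proof.
move=> ha; elim: l => [|j l IH].
  rewrite big_nil (_ : (fun _ => _) = fun=> 0); last first.
    by apply/funext => nu; rewrite big_nil.
  exists 1, 0; split=> [|nu|z _]; rewrite ?ltr01 ?normr0 ?mul0r//.
  rewrite (_ : box_sum _ _ = fun=> 0); first exact: cvg_cst.
  by apply/funext => N; rewrite /box_sum big1// => nu _; rewrite mul0r.
rewrite big_cons (_ : (fun _ => _) = fun nu => a j nu + \sum_(j <- l) a j nu).
  exact: (representsD (ha j) IH).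
by apply/funext => nu; rewrite big_cons.
Qed.

Lemma germ_ring_noetherian (X : germ R n) : noetherian (germ_ring X).
Proof.
move=> I [I0 ID IM].
(* Leading exponents of the functions whose class lies in I. Each function is paired with an
   expansion from which the exponent is read. *)
pose E e := exists fa : hol_fun (base X) * (multi_index n -> C),
  [/\ I (germ_class fa.1), represents (base X) fa.2 fa.1, fa.2 e != 0 &
    forall nu, fa.2 nu != 0 -> nu = e \/ lex_lt e nu].
have [s [sE sdom]] := dickson E.
pose e (j : 'I_(size s)) := tnth (in_tuple s) j.
have /choice[fa faP] : forall j, exists fa : hol_fun (base X) * (multi_index n -> C),
  [/\ I (germ_class fa.1), represents (base X) fa.2 fa.1, fa.2 (e j) != 0 &
    forall nu, fa.2 nu != 0 -> nu = e j \/ lex_lt (e j) nu].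
  by move=> j; apply: sE; exact: mem_tnth.
exists (size s), (\col_j germ_class (fa j).1); split=> [j|y Iy].
  by rewrite mxE; have [] := faP j.
pose f := germ_repr y; have [a af] := hol_fun_represented f.
have [r [M [r0 ha _]]] := af.
have [|||Q [rem [[r1 [M1 [r10 remb]]] Qb remdom aE]]] :=
    @division R n 'I_(size s) e (fun j => (fa j).2) _ _ _ a r M r0 ha.
- by move=> j; have [_ [r' [M' [r'0 h _]]] _ _] := faP j; exists r', M'.
- by move=> j; have [] := faP j.
- by move=> j; have [] := faP j.
have /choice[h hQ] : forall j, exists h : hol_fun (base X), represents (base X) (Q j) h.
  by move=> j; have [r' [M' [r'0 hM]]] := Qb j; exact: represents_exists r'0 hM.
pose g : hol_fun (base X) := \sum_j h j * (fa j).1.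
have gE : represents (base X) (fun nu => \sum_j conv (Q j) (fa j).2 nu) g.
  apply: represents_sum => j; have [_ faj _ _] := faP j.
  exact: (representsM (hQ j) faj).
have gclass : germ_class g = \sum_j germ_class (h j) * germ_class (fa j).1.
  by rewrite rmorph_sum; apply: eq_bigr => j _; rewrite rmorphM.
have Ig : I (germ_class g).
  by rewrite gclass; apply: ideal_sum => // j; have [] := faP j.
(* The remainder represents f - g, whose class lies in I. If nonzero, its least exponent would be in
   E, hence above some [e j], where the remainder vanishes. *)
have rem0 nu : rem nu = 0.
  apply: contrapT => nz.
  have [|e0 [/eqP e0nz min]] := @lex_min n (fun nu => rem nu <> 0); first by exists nu.
  have If : I (germ_class (f - g)).
    have -> : germ_class (f - g) = y + - germ_class g.
      by rewrite rmorphB; congr (_ - _); exact: germ_reprK.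
    apply: (ID _ _ Iy).
    by rewrite -mulN1r; exact: IM.
  have rf : represents (base X) rem (f - g : hol_fun (base X)).
    have -> : rem = fun nu => a nu + - \sum_j conv (Q j) (fa j).2 nu.
      by apply/funext => mu; rewrite aE addrAC subrr add0r.
    exact: (representsD af (representsN gE)).
  have [|e1 [e1s le]] := sdom e0.
    exists (f - g, rem); split; [exact: If|exact: rf|exact: e0nz|].
    by move=> mu /eqP; exact: min.
  have [j jE] : exists j, e j = e1.
    by have /tnthP[j ->] : e1 \in in_tuple s by []; exists j.
  by rewrite (remdom e0 j) ?eqxx// jE in e0nz.
have ag : represents (base X) a g.
  rewrite (_ : a = fun nu => \sum_j conv (Q j) (fa j).2 nu)//.
  by apply/funext => nu; rewrite aE rem0 addr0.
exists (\row_j germ_class (h j)).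
rewrite mxE -[y]germ_reprK -/f.
have -> : germ_class f = germ_class g.
  apply/germ_classP; apply: filterS (represents_unique af ag) => z fg _.
  exact: fg.
by rewrite gclass; apply: eq_bigr => j _; rewrite !mxE.
Qed.

(** Quantitative continuity at the centre: writing u = d v with v in the quarter polydisc, every
    monomial except the constant one gains a factor at most d. *)
Lemma box_sum_near0 (a : multi_index n -> C) (r M d : C) (u : 'rV[C]_n) N :
  0 < r -> (forall nu, `|a nu| * r ^+ degree nu <= M) -> 0 < d -> d <= 1 ->
  (forall i, `|u 0 i| <= d * (r / 4%:R)) -> (0 < N)%N ->
  `|box_sum a u N - a [ffun=> 0%N]| <= M * 2 ^+ n * d.
Proof.
move=> r0 ha d0 d1 ud N0; have M0 := coef_bound_ge0 r0 ha.
have hh k : 0 <= half ^+ k by rewrite exprn_ge0// half_ge0.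
pose v := d^-1 *: u.
have vr i : `|v 0 i| <= r / 4%:R.
  by rewrite mxE normrM normfV (gtr0_norm d0) ler_pdivrMl.
have uE nu : monomial u nu = d ^+ degree nu * monomial v nu.
  rewrite /monomial /degree -prodrXr -big_split; apply: eq_bigr => i _ /=.
  by rewrite -exprMn mxE mulrA divff ?mul1r// gt_eqF.
rewrite /box_sum (bigD1 [ffun=> Ordinal N0])//=.
rewrite (_ : of_box _ = [ffun=> 0%N]); last by apply/ffunP => i; rewrite !ffunE.
rewrite {1}/monomial big1 => [|i _]; last by rewrite ffunE expr0.
rewrite mulr1 addrAC subrr add0r; apply: le_trans (ler_norm_sum _ _ _) _.
rewrite -mulrA [2 ^+ n * d]mulrC mulrA.
apply: le_trans (ler_wpM2l _ (geometric_box R n N)); last by rewrite mulr_ge0// ltW.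
rewrite mulr_sumr [leRHS](bigD1 [ffun=> Ordinal N0])//=.
apply: ler_wpDl; first by rewrite !mulr_ge0// ltW.
apply: ler_sum => nu nu0; rewrite uE mulrCA normrM.
have [i nui] : exists i, (0 < of_box nu i)%N.
  apply: contrapT => none; case/eqP: nu0; apply: (@of_box_inj _ N).
  apply/ffunP => i; rewrite !ffunE; apply/eqP; rewrite -leqn0 leqNgt; apply/negP => lt.
  by apply: none; exists i; rewrite ffunE.
have deg0 : (0 < degree (of_box nu))%N by apply: leq_trans nui (le_degree _ i).
rewrite [M * d]mulrC -mulrA; apply: ler_pM => //.
  rewrite normrX gtr0_norm//; case: degree deg0 => // k _.
  by rewrite exprS; apply: ler_piMr; [exact: ltW|apply: exprn_ile1 => //; exact: ltW].
apply: le_trans (term_bound _ r0 ha vr) _; rewrite ler_wpM2l//.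
by rewrite ler_piMl// exprn_ile1 ?half_ge0 ?half_le1.
Qed.

Lemma hol_fun_nonzero_near (x : 'rV[C]_n) (f : hol_fun x) :
  f x != 0 -> \forall z \near x, f z != 0.
Proof.
move=> fx; have [a [r [M [r0 ha fa]]]] := hol_fun_represented f.
have M0 := coef_bound_ge0 r0 ha.
(* The 4 makes the variation of the partial sums at most |f x|/4. Another quarter goes to
   approximating f z by a partial sum, so f z and f x are both within |f x|/2 of the constant
   coefficient. *)
have K0 : 0 <= M * 2 ^+ n * 4%:R by rewrite !mulr_ge0// exprn_ge0.
have fx0 : 0 < `|f x| by rewrite normr_gt0.
have [B hB] := exists_half_le K0 fx0.
pose d := half ^+ B; have d0 : 0 < d by rewrite exprn_gt0// invr_gt0.
have d1 : d <= 1 by rewrite exprn_ile1 ?half_ge0 ?half_le1.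
have r40 : 0 < r / 4%:R by rewrite divr_gt0.
have r4r : r / 4%:R <= r.
  by rewrite ler_pdivrMr// mulr_natr mulrS lerDl mulrn_wge0// ltW.
have near_a (z : 'rV[C]_n) : (forall i, `|z 0 i - x 0 i| < d * (r / 4%:R)) ->
    `|f z - a [ffun=> 0%N]| < `|f x| / 2.
  move=> zd.
  have zr i : `|z 0 i - x 0 i| < r.
    apply: lt_le_trans (zd i) (le_trans _ r4r); by rewrite ler_piMl// ltW.
  have e0 : 0 < `|f x| / 4%:R by rewrite divr_gt0.
  have /cvgrPdist_lt/(_ _ e0)[N _ /(_ N.+1 (leqnSn N))] := fa z zr.
  move=> close; rewrite -(subrK (box_sum a (z - x) N.+1) (f z)) -addrA.
  apply: le_lt_trans (ler_normD _ _) _.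
  rewrite (_ : `|f x| / 2 = `|f x| / 4%:R + `|f x| / 4%:R); last by field.
  apply: ltr_leD => //.
  apply: le_trans (box_sum_near0 (d := d) r0 ha _ _ _ _) _ => // [i|].
    by rewrite !mxE ltW.
  by rewrite ler_pdivlMr// mulrAC.
apply: filterS (near_polydisc x (mulr_gt0 d0 r40)) => z /near_a za.
have xa : `|f x - a [ffun=> 0%N]| < `|f x| / 2.
  by apply: near_a => i; rewrite subrr normr0 mulr_gt0.
apply/eqP => fz; move: za; rewrite fz sub0r normrN => za.
have : `|f x| < `|f x|; last by rewrite ltxx.
rewrite -{1}(subrK (a [ffun=> 0%N]) (f x)); apply: le_lt_trans (ler_normD _ _) _.
by rewrite [ltRHS](_ : _ = `|f x| / 2 + `|f x| / 2) ?ltrD//; field.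
Qed.

End GermRing.

(** * Fiber products of noetherian rings *)

Section FiberProductNoetherian.
Variables (A B S : comNzRingType) (f : {rmorphism A -> S}) (g : {rmorphism B -> S}).
Hypothesis f_surj : forall s, exists a, f a = s.
Hypothesis g_surj : forall s, exists b, g b = s.
Local Notation P := (fiber_product f g).

Lemma fiber_pair a b : f a = g b -> exists p : P, fiber_fst p = a /\ fiber_snd p = b.
Proof.
move=> fg; have ab : (a, b) \in fiber_pred f g by rewrite inE /= fg.
by exists (FiberProduct ab).
Qed.

Lemma fiber_fst_surj a : exists p : P, fiber_fst p = a.
Proof.
have [b gb] := g_surj (f a); have [p [pa _]] := fiber_pair (esym gb).
by exists p.
Qed.

Lemma fiber_snd_surj b : exists p : P, fiber_snd p = b.
Proof.
have [a fa] := f_surj (g b); have [p [_ pb]] := fiber_pair fa.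
by exists p.
Qed.

Lemma fiber_eq (p q : P) :
  fiber_fst p = fiber_fst q -> fiber_snd p = fiber_snd q -> p = q.
Proof.
case: p q => -[a b] ab [[c d] cd]; rewrite /fiber_fst /fiber_snd /= => ac bd.
by apply/val_inj => /=; rewrite ac bd.
Qed.

Lemma fiber_glue (p : P) : f (fiber_fst p) = g (fiber_snd p).
Proof. by apply/eqP; case: p. Qed.

(** An ideal I has an image I1 in A and a part I2 with first component 0, which is an ideal of B
    because the second projection is surjective. Lifts of generators of both generate I. *)
Lemma fiber_product_noetherian : noetherian A -> noetherian B -> noetherian P.
Proof.
move=> noethA noethB I idI; have [I0 ID IM] := idI.
pose I1 a := exists p : P, I p /\ fiber_fst p = a.
pose I2 b := exists p : P, [/\ I p, fiber_fst p = 0 & fiber_snd p = b].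
have idI1 : is_ideal I1.
  split; first by exists 0; rewrite rmorph0.
    move=> _ _ [p [Ip <-]] [q [Iq <-]]; exists (p + q).
    by rewrite rmorphD; split; first exact: ID.
  move=> c _ [p [Ip <-]]; have [q <-] := fiber_fst_surj c.
  by exists (q * p); rewrite rmorphM; split; first exact: IM.
have idI2 : is_ideal I2.
  split; first by exists 0; rewrite !rmorph0.
    move=> _ _ [p [Ip p0 <-]] [q [Iq q0 <-]]; exists (p + q).
    split; [exact: ID|by rewrite rmorphD /= p0 q0 addr0|exact: rmorphD].
  move=> c _ [p [Ip p0 <-]]; have [q <-] := fiber_snd_surj c.
  exists (q * p); split; [exact: IM|by rewrite rmorphM /= p0 mulr0|exact: rmorphM].
have [k [u [/choice[x xP] ugen]]] := noethA _ idI1.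
have [l [v [/choice[y yP] vgen]]] := noethB _ idI2.
exists (k + l)%N, (col_mx (\col_i x i) (\col_i y i)); split=> [i|p Ip].
  rewrite mxE; case: (fintype.split i) => j; rewrite mxE; [by case: (xP j)|by case: (yP j)].
have [w wE] := ugen _ (ex_intro _ p (conj Ip erefl)).
have [W WE] := choice (fun i => fiber_fst_surj (w 0 i)).
pose q : P := \sum_i W i * x i.
have Ipq : I (p - q).
  apply: ID => //; rewrite -mulN1r; apply: IM; apply: ideal_sum => // i.
  by case: (xP i).
have pq0 : fiber_fst (p - q) = 0.
  rewrite rmorphB /= wE mxE rmorph_sum -sumrB big1// => i _.
  by rewrite rmorphM /= WE; case: (xP i) => _ ->; rewrite subrr.
have [|w' w'E] := vgen (fiber_snd (p - q)); first by exists (p - q).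
have [W' W'E] := choice (fun i => fiber_snd_surj (w' 0 i)).
exists (row_mx (\row_i W i) (\row_i W' i)).
rewrite mul_row_col mxE [X in X + _]mxE [X in _ + X]mxE.
under eq_bigr do rewrite !mxE; under [X in _ + X]eq_bigr do rewrite !mxE.
rewrite -/q -[p in LHS](subrK q) addrC; congr (_ + _).
apply: fiber_eq; rewrite ?pq0 ?w'E rmorph_sum.
  by rewrite big1// => i _; rewrite rmorphM /=; case: (yP i) => _ -> _; rewrite mulr0.
rewrite mxE; apply: eq_bigr => i _; rewrite rmorphM /= W'E.
by case: (yP i) => _ _ ->.
Qed.

End FiberProductNoetherian.

Lemma kernel_is_ideal (A B : nzRingType) (phi : {rmorphism A -> B}) :
  is_ideal (fun a => phi a = 0).
Proof.
split=> [|a b a0 b0|c a a0]; first exact: rmorph0.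
  by rewrite rmorphD a0 b0 addr0.
by rewrite rmorphM a0 mulr0.
Qed.

Section KernelIdeal.
Variables (A B : comNzRingType) (phi : {rmorphism A -> B}).

Definition kernel : {pred A} := [pred a | phi a == 0].

Lemma kernel_idealr : idealr_closed kernel.
Proof.
split=> [||a u v]; rewrite !inE ?rmorph0 ?rmorph1 ?oner_eq0// => /eqP u0 /eqP v0.
by rewrite rmorphD rmorphM u0 v0 mulr0 addr0.
Qed.

HB.instance Definition _ := isIdealr.Build A kernel kernel_idealr.

(** [large] ranges over [idealr]; in this form the kernel of the pullback along alpha can stand for
    the subspace Z. *)
Definition kernel_ideal : idealr A := kernel.

Lemma quotient_kernelP a : quotient_map kernel_ideal a = 0 <-> phi a = 0.
Proof.
rewrite -(rmorph0 (quotient_map kernel_ideal)); split=> [/eqP|a0].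
  by rewrite -Quotient.idealrBE subr0 inE => /eqP.
by apply/eqP; rewrite -Quotient.idealrBE subr0 inE a0.
Qed.

End KernelIdeal.

Lemma quotient_map_surj (A : comNzRingType) (I : idealr A) b :
  exists a, quotient_map I a = b.
Proof. by exists (repr b); exact: reprK. Qed.

(** Both quotients are resolved by the same syzygies of their common kernel. This passes from O_X
    modulo the kernel of the pullback, to which largeness applies, to O_Z itself. *)
Lemma alg_betti_kernel (A B C : comNzRingType) (K : fieldType) (ev : {rmorphism A -> K})
    (phi : {rmorphism A -> B}) (psi : {rmorphism A -> C}) :
  noetherian A -> (forall b, exists a, phi a = b) -> (forall c, exists a, psi a = c) ->
  (forall a, phi a = 0 <-> psi a = 0) -> (forall a, phi a = 0 -> ev a = 0) ->
  alg_betti ev phi =1 alg_betti ev psi.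
Proof.
move=> noethA phi_surj psi_surj ker evphi i.
have [s] := syzygies_exist noethA (kernel_is_ideal phi).
have [p0 p1 p2] := betti_cyclic phi_surj (fun=> iff_refl _) s evphi.
have [q0 q1 q2] := betti_cyclic psi_surj ker s evphi.
by case: i => [|[|i]]; rewrite ?p0 ?p1 ?p2 ?q0 ?q1 ?q2.
Qed.

Section Germs.
Variables (R : realType) (n : nat) (X : germ R n).

Lemma residue_surj (k : Cplx R) : exists s : germ_ring X, residue s = k.
Proof.
have holk : (fun=> k) \in holomorphic_pred (base X).
  by apply/holomorphic_predP; exact: holomorphic_at_cst.
by exists (germ_class (HolFun holk)); rewrite residueE.
Qed.

(** Values of germs lie in a field, so a nilpotent germ vanishes pointwise. Applied to O_Z, this
    makes the kernel of the pullback radical. *)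
Lemma germ_ring_reduced (s : germ_ring X) k : s ^+ k = 0 -> s = 0.
Proof.
have [f <-] : exists f : hol_fun (base X), germ_class f = s.
  by exists (germ_repr s); exact: germ_reprK.
rewrite -rmorphXn -(rmorph0 (@germ_class _ _ X)) => /germ_classP h.
apply/germ_classP; apply: filterS h => z h Xz; have := h Xz.
have -> : (f ^+ k : hol_fun _) z = f z ^+ k.
  by elim: k {h} => [|k IH]; rewrite ?expr0// !exprS -IH.
by move/eqP; rewrite expf_eq0 => /andP[_ /eqP].
Qed.

Lemma germ_ring_cancel (u s : germ_ring X) : residue u != 0 -> u * s = 0 -> s = 0.
Proof.
rewrite -[u]germ_reprK -[s]germ_reprK residueE -rmorphM -(rmorph0 (@germ_class _ _ X)).
move=> /hol_fun_nonzero_near u0 /germ_classP us; apply/germ_classP.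
apply: filterS2 u0 us => z u0 us Xz; have /eqP := us Xz.
by rewrite mulf_eq0 (negbTE u0) => /eqP.
Qed.

Lemma residue_pullback l (Z : germ R l) (a : germ_morphism Z X) (s : germ_ring X) :
  residue (pullback a s) = residue s.
Proof.
rewrite -[s]germ_reprK; have [h hs] := mor_hol a (germ_repr s).
rewrite (pullbackE hs) !residueE (nbhs_singleton hs) ?mor_base//.
exact: base_locus.
Qed.

Lemma betti1_pullback_neq0 l (Z : germ R l) (a : germ_morphism Z X) :
  (forall h, exists s, pullback a s = h) -> ~ bijective (pullback a) ->
  alg_betti (@residue _ _ X) (pullback a) 1 <> 0%N.
Proof.
move=> a_surj a_not_iso b0; apply: a_not_iso.
have evI s : pullback a s = 0 -> residue s = 0.
  by rewrite -(residue_pullback a) => ->; rewrite rmorph0.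
have [sy] := syzygies_exist (@germ_ring_noetherian _ _ X) (kernel_is_ideal (pullback a)).
have [u [u1 ukill]] :=
  nakayama_betti1 a_surj (fun=> iff_refl _) sy evI residue_surj b0.
(* [u] has residue 1, hence is nonzero near the base point and can be cancelled; the kernel that it
   annihilates is therefore zero. *)
have inj : injective (pullback a).
  move=> s t /eqP; rewrite -subr_eq0 -rmorphB => /eqP /ukill st.
  by apply/eqP; rewrite -subr_eq0; apply/eqP/(germ_ring_cancel _ st); rewrite u1 oner_eq0.
have [g gK] := choice a_surj.
by exists g => // s; apply: inj; rewrite gK.
Qed.

End Germs.

(** * Betti numbers of a large gluing *)

Section LargeGluing.
Variables (R : realType) (n m l : nat) (X : germ R n) (Y : germ R m) (Z : germ R l).
Variables (alpha : germ_morphism Z X) (beta : germ_morphism Z Y).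
Hypothesis alpha_surj : forall h, exists s, pullback alpha s = h.
Hypothesis beta_surj : forall h, exists t, pullback beta t = h.

Local Notation bV := (alg_betti (glue_residue alpha beta)).
Local Notation bX := (alg_betti (@residue _ _ X)).
Local Notation J := (kernel_ideal (pullback alpha)).

Lemma glue_ring_noetherian : noetherian (glue_ring alpha beta).
Proof. by apply: fiber_product_noetherian => //; exact: germ_ring_noetherian. Qed.

Lemma kernel_radical : radical J.
Proof.
move=> a k /eqP ak; apply/eqP; apply: (germ_ring_reduced (k := k)).
by rewrite -ak rmorphXn.
Qed.

Lemma glue_fst_surj s : exists p, glue_fst alpha beta p = s.
Proof. exact: fiber_fst_surj. Qed.

Lemma glue_snd_surj t : exists p, glue_snd alpha beta p = t.
Proof. exact: fiber_snd_surj. Qed.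

Lemma betti_gluing :
  [/\ bV (glue_fst alpha beta) 0 = 1%N,
      bV (quotient_map J \o glue_fst alpha beta) 0 = 1%N
    & forall i, bV (quotient_map J \o glue_fst alpha beta) i.+1 =
        (bV (glue_fst alpha beta) i.+1 + bV (glue_snd alpha beta) i.+1)%N].
Proof.
set f := glue_fst alpha beta; set g := glue_snd alpha beta.
pose h : {rmorphism _ -> _} := quotient_map J \o f.
have noeth := glue_ring_noetherian.
have hP p : h p = 0 <-> pullback alpha (f p) = 0 by exact: quotient_kernelP.
have h_surj c : exists p, h p = c.
  have [a <-] := quotient_map_surj c; have [p <-] := glue_fst_surj a.
  by exists p.
have evh p : h p = 0 -> glue_residue alpha beta p = 0.
  by move=> /hP p0; rewrite /= -(residue_pullback alpha) p0 rmorph0.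
have evf p : f p = 0 -> glue_residue alpha beta p = 0.
  by move=> p0; apply/evh/hP; rewrite p0 rmorph0.
have [s] := syzygies_exist noeth (kernel_is_ideal f).
have [t] := syzygies_exist noeth (kernel_is_ideal g).
have [r] := syzygies_exist noeth (kernel_is_ideal h).
split.
- by have [] := betti_cyclic glue_fst_surj (fun=> iff_refl _) s evf.
- by have [] := betti_cyclic h_surj (fun=> iff_refl _) r evh.
apply: (betti_sum _ _ s t glue_fst_surj glue_snd_surj h_surj
  (fun=> iff_refl _) (fun=> iff_refl _) (fun=> iff_refl _) evh).
  move=> p; rewrite hP; split=> [p0|[b [c [b0 c0 ->]]]].
    (* As p maps to 0 in O_Z, the pair (f p, 0) belongs to the fiber product. It is killed by g, and
       its difference from p by f. *)
    have [|c [cE c0]] := @fiber_pair _ _ _ (pullback alpha) (pullback beta) (f p) 0.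
      by rewrite rmorph0; exact: p0.
    exists (p - c), c; rewrite subrK; split=> //.
    by rewrite rmorphB; apply/eqP; rewrite subr_eq0; apply/eqP.
  rewrite (_ : f (b + c) = f c); last by rewrite -[RHS]add0r -b0; exact: rmorphD.
  by have := fiber_glue c; rewrite -/(glue_snd alpha beta c) c0 rmorph0.
move=> p p0 /eqP; rewrite rmorphN oppr_eq0 => /eqP q0.
by apply: fiber_eq; rewrite rmorph0.
Qed.

Hypothesis glue_large : large_gluing alpha beta.

Lemma large_gluing_betti :
  bX (pullback alpha) 0 = 1%N /\ forall i, (bV (glue_fst alpha beta) i.+1 +
    bV (glue_snd alpha beta) i.+1 = series_mul (bX (pullback alpha))
      (bV (glue_fst alpha beta)) i.+1)%N.
Proof.
have evI s : pullback alpha s = 0 -> residue s = 0.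
  by rewrite -(residue_pullback alpha) => ->; rewrite rmorph0.
split=> [|i].
  have [sy] := syzygies_exist (@germ_ring_noetherian _ _ X) (kernel_is_ideal (pullback alpha)).
  by have [] := betti_cyclic alpha_surj (fun=> iff_refl _) sy evI.
have [_ _ <-] := betti_gluing.
rewrite -/(poincare _ _ _) (glue_large kernel_radical); apply: eq_bigr => j _.
congr (_ * _)%N; apply: (alg_betti_kernel (@germ_ring_noetherian _ _ X)) => //.
- exact: quotient_map_surj.
- exact: quotient_kernelP.
- by move=> a /quotient_kernelP; exact: evI.
Qed.

End LargeGluing.

Theorem corollary3p12 (R : realType) (n m l : nat)
    (X : germ R n) (Y : germ R m) (Z : germ R l)
    (alpha : germ_morphism Z X) (beta : germ_morphism Z Y)
    (alpha_surj : forall h, exists s, pullback alpha s = h)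
    (beta_surj : forall h, exists t, pullback beta t = h)
    (alpha_not_iso : ~ bijective (pullback alpha))
    (beta_not_iso : ~ bijective (pullback beta))
    (glue_large : large_gluing alpha beta)
    (I : idealr (germ_ring X)) (I_radical : radical I) :
  let bXW i : rat := (alg_betti (@residue _ _ X) (quotient_map I) i)%:R in
  let bXZ i : rat := (alg_betti (@residue _ _ X) (pullback alpha) i)%:R in
  let bVW i : rat := (alg_betti (glue_residue alpha beta)
                        (quotient_map I \o glue_fst alpha beta) i)%:R in
  let bVY i : rat := (alg_betti (glue_residue alpha beta)
                        (glue_snd alpha beta) i)%:R in
  let k := bXZ 2%N / bXZ 1%N in
  [/\ bVW 0%N = bXW 0%N * bVY 1%N / bXZ 1%N,
      bVW 1%N = 1 / bXZ 1%N *
        (bVY 1%N * (bXW 1%N * bXZ 1%N - bXW 0%N * bXZ 2%N) / bXZ 1%N + bXW 0%N * bVY 2%N)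
    & bVW 2%N =
        bXW 0%N / bXZ 1%N *
          (bVY 3%N + bVY 1%N / bXZ 1%N * (bXZ 2%N * k - bXZ 3%N) - k * bVY 2%N)
        + bXW 1%N / bXZ 1%N * (bVY 2%N - k * bVY 1%N)
        + bXW 2%N * bVY 1%N / bXZ 1%N].
Proof.
move=> bXW bXZ bVW bVY k.
have [c0 _ _] := betti_gluing alpha_surj beta_surj.
have [b0 rel] := large_gluing_betti alpha_surj beta_surj glue_large.
have b1 : bXZ 1%N != 0 by rewrite pnatr_eq0; apply/eqP; exact: betti1_pullback_neq0.
pose c i : rat := (alg_betti (glue_residue alpha beta) (glue_fst alpha beta) i)%:R.
have relE i : c i.+1 + bVY i.+1 = \sum_(j < i.+2) bXZ j * c (i.+1 - j)%N.
  rewrite -natrD rel /series_mul natr_sum.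
  by apply: eq_bigr => j _; rewrite natrM.
have wE i : bVW i = \sum_(j < i.+1) bXW j * c (i - j)%N.
  rewrite /bVW -/(poincare _ _ i) (glue_large _ I_radical) /series_mul natr_sum.
  by apply: eq_bigr => j _; rewrite natrM.
have {}b0 : bXZ 0%N = 1 by rewrite /bXZ b0.
have {}c0 : c 0%N = 1 by rewrite /c c0.
have := (relE 0%N, (relE 1%N, relE 2%N)).
rewrite !big_ord_recr !big_ord0 /= !subSS !subn0 b0 c0 => -[e1 [e2 e3]].
(* Since beta_0^X(Z) = 1, the highest unknown [c] occurs with coefficient 1 on both sides and
   cancels. *)
have y1 : bVY 1%N = bXZ 1%N by lra.
have y2 : bVY 2%N = bXZ 2%N + bXZ 1%N * c 1%N by lra.
have y3 : bVY 3%N = bXZ 3%N + bXZ 2%N * c 1%N + bXZ 1%N * c 2%N by lra.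
rewrite !wE !big_ord_recr !big_ord0 /= !subSS !subn0 c0.
(* What remains are rational identities in the Betti numbers over X, [c 1] and [c 2], whose only
   denominator is beta_1^X(Z), nonzero by [b1]. *)
by rewrite /k y1 y2 y3; split; field.
Qed.
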